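(* Suppose that $R(\mathfrak m)\cap\tilde{\mathfrak m}\neq\emptyset$ and $\mathfrak k^x=\mathfrak z(\mathfrak g)$ for all $x\in R(\mathfrak m)$. Assume that there exists a system of simple roots $\pi$ of $\Delta$ such that $\pi\subset\Delta_{\mathfrak m}$ and some vector $$x_\pi=\sum_{\alpha\in\pi}c_\alpha E_{-\alpha}+\sum_{\beta\in\Delta^+_{\mathfrak m}}d_\beta E_\beta,\qquad c_\alpha\in\mathbb C\setminus\{0\}\ (\alpha\in\pi),\quad d_\beta\in\mathbb C\ (\beta\in\Delta^+_{\mathfrak m}),$$ where $\Delta^+$ is the system of positive roots of $\Delta$ determined by $\pi$ and $\Delta^+_{\mathfrak m}=\Delta_{\mathfrak m}\cap\Delta^+$, belongs to the space $\tilde{\mathfrak m}^{\mathbb C}\subset\mathfrak m^{\mathbb C}$. Then the set $M_a(\mathfrak m)\cap\tilde{\mathfrak m}$ is nonempty.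
   Context: Let $G$ be a compact connected Lie group with Lie algebra $\mathfrak g$, and let $\langle\cdot,\cdot\rangle=-\Phi_\chi$, where $\chi$ is a faithful representation of $\mathfrak g$ whose associated bilinear (trace) form $\Phi_\chi$ is negative definite on $\mathfrak g$; $\langle\cdot,\cdot\rangle$ is an invariant scalar product on $\mathfrak g$. Let $\sigma$ be an involutive automorphism of $\mathfrak g$, and assume $\langle\cdot,\cdot\rangle$ is $\sigma$-invariant. Let $\mathfrak g=\tilde{\mathfrak g}\oplus\mathfrak g'$ be the decomposition into the $+1$ and $-1$ eigenspaces of $\sigma$. Fix $a\in\mathfrak g'$, put $\mathfrak k=\mathfrak g^a$ (for $x\in\mathfrak g$, $\mathfrak g^x$ denotes the centralizer of $x$ in $\mathfrak g$) and $\mathfrak m=\mathfrak k^\perp$ in $\mathfrak g$; $\mathfrak m$ is $\sigma$-invariant and $\tilde{\mathfrak m}=\mathfrak m\cap\tilde{\mathfrak g}$. The superscript $\mathbb C$ denotes complexification and $\mathfrak z(\mathfrak g)$ the center of $\mathfrak g$. For $x\in\mathfrak m$ put $\mathfrak k^x=\mathfrak g^x\cap\mathfrak k$. Let $q(\mathfrak m)=\min_{y\in\mathfrak m}\dim\mathfrak g^y$, $p(\mathfrak m)=\min_{y\in\mathfrak m}\dim\mathfrak k^y$ and $R(\mathfrak m)=\{x\in\mathfrak m:\dim\mathfrak g^x=q(\mathfrak m),\ \dim\mathfrak k^x=p(\mathfrak m)\}$. Put $$M_a(\mathfrak m)=\{x\in\mathfrak m:\dim_{\mathbb C}(\mathfrak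 g^{\mathbb C})^{x+\lambda a}=q(\mathfrak m)\text{ for each }\lambda\in\mathbb C\}.$$ Let $\mathfrak t$ be a Cartan subalgebra of $\mathfrak g$ containing $a$; then $\mathfrak t^{\mathbb C}$ is a Cartan subalgebra of the reductive Lie algebra $\mathfrak g^{\mathbb C}$ and of $\mathfrak k^{\mathbb C}$. Let $\Delta$ be the root system of $(\mathfrak g^{\mathbb C},\mathfrak t^{\mathbb C})$, $\Delta_{\mathfrak k}=\{\alpha\in\Delta:\alpha(a)=0\}$ (the root system of $(\mathfrak k^{\mathbb C},\mathfrak t^{\mathbb C})$) and $\Delta_{\mathfrak m}=\Delta\setminus\Delta_{\mathfrak k}$, so that $\mathfrak m^{\mathbb C}=\sum_{\alpha\in\Delta_{\mathfrak m}}\mathfrak g^\alpha$, where $\mathfrak g^\alpha$ is the root space of $\alpha$. $\{E_\alpha:\alpha\in\Delta\}$ is a Weyl basis of $\mathfrak g^{\mathbb C}$ modulo $\mathfrak t^{\mathbb C}$ with $E_\alpha\in\mathfrak g^\alpha$, chosen such that the compact form $\mathfrak g$ is spanned by $\mathfrak t$ and the vectors $E_\alpha-E_{-\alpha}$, $i(E_\alpha+E_{-\alpha})$, $\alpha\in\Delta$. *)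

(* Defs.v *)
From HB Require Import structures.
From mathcomp Require Import all_boot all_order all_algebra.
From mathcomp Require Import boolp classical_sets functions cardinality fsbigop.
From mathcomp Require Import reals.
From mathcomp Require Import complex.
From mathcomp Require Import lra.

Set Implicit Arguments.
Unset Strict Implicit.
Unset Printing Implicit Defensive.
Import GRing.Theory Num.Theory.

Local Open Scope classical_set_scope.
Local Open Scope ring_scope.

(** * Finite-dimensional Lie algebras *)

HB.mixin Record isLieAlgebra (K : fieldType) (L : Type) of Vector K L := {
  lie : L -> L -> L;
  lie_linearl_subproof : forall y, linear (lie^~ y);
  lie_linearr_subproof : forall x, linear (lie x);
  liexx : forall x, lie x x = 0;
  lie_jacobi : forall x y z,
    lie x (lie y z) + lie y (lie z x) + lie z (lie x y) = 0 }.

#[short(type="lieAlgebraType")]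
HB.structure Definition LieAlgebra (K : fieldType) :=
  { L of Vector K L & isLieAlgebra K L }.

Section LieAlgebraTheory.
Variables (K : fieldType) (L : lieAlgebraType K).
Implicit Types (x y : L) (U V t : {vspace L}).

HB.instance Definition _ x :=
  GRing.isLinear.Build K L L _ (lie x) (lie_linearr_subproof x).

Lemma lie_anti x y : lie x y = - lie y x.
Proof.
have linl z := lie_linearl_subproof z.
apply/eqP; rewrite -subr_eq0 opprK; apply/eqP.
have := liexx (x + y); rewrite -{1}[x]scale1r linl scale1r !linearD /= !liexx.
by rewrite add0r addr0.
Qed.

Definition ad x : 'End(L) := linfun (lie x).

Fact ad_is_linear : linear ad.
Proof.
move=> k x y; apply/lfunP => z.
by rewrite add_lfunE scale_lfunE !lfunE /= (lie_linearl_subproof z).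
Qed.
HB.instance Definition _ := GRing.isLinear.Build K L 'End(L) _ ad ad_is_linear.

Definition lie_cent x : {vspace L} := lker (ad x).
Definition lie_center : {vspace L} := lker (linfun ad).

Lemma mem_lie_cent x y : (y \in lie_cent x) = (lie x y == 0).
Proof. by rewrite memv_ker lfunE. Qed.

Lemma mem_lie_center x : x \in lie_center <-> forall y, lie x y = 0.
Proof.
rewrite memv_ker lfunE /=; split=> [/eqP adx0 y|x0].
  by have /lfunP/(_ y) := adx0; rewrite lfunE zero_lfunE.
by apply/eqP/lfunP => y; rewrite lfunE zero_lfunE /= x0.
Qed.

Definition lie_prodv U V : {vspace L} :=
  <<[seq lie u v | u <- vbasis U, v <- vbasis V]>>%VS.

Definition lie_subalgebra U : Prop := (lie_prodv U U <= U)%VS.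

Definition lie_nilpotent U : Prop :=
  exists n, iter n (lie_prodv U) U = 0%VS.

(** Cartan subalgebra: a nilpotent subalgebra equal to its own normalizer. *)
Definition cartan_subalgebra t : Prop :=
  [/\ lie_subalgebra t, lie_nilpotent t
    & forall x, (forall h, h \in t -> lie x h \in t) -> x \in t].

Definition lie_automorphism (s : 'End(L)) : Prop :=
  bijective s /\ forall x y, s (lie x y) = lie (s x) (s y).

End LieAlgebraTheory.

(** [min_dim U F] is the minimum of [\dim (F y)] for [y] in [U]. *)
Section MinDim.
Variables (K : fieldType) (V : vectType K) (U : {vspace V}).
Variable F : V -> {vspace V}.

Fact min_dim_subproof :
  exists n, `[< exists2 y, y \in U & \dim (F y) = n >].
Proof. by exists (\dim (F 0)); apply/asboolP; exists 0; rewrite ?mem0v. Qed.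

Definition min_dim : nat := ex_minn min_dim_subproof.

End MinDim.

(** * Trace forms *)

Section TraceForm.
Variables (K : fieldType) (L : lieAlgebraType K) (n : nat).
Variable chi : {linear L -> 'M[K]_n}.

Definition lie_representation : Prop :=
  forall x y, chi (lie x y) = chi x *m chi y - chi y *m chi x.

Definition trace_form (x y : L) : K := \tr (chi x *m chi y).

(** The scalar product [- Phi_chi] when [trace_form] is negative definite. A real
    Lie algebra with a faithful representation whose trace form is negative
    definite is the Lie algebra of a compact connected Lie group, so the group
    needs no hypothesis of its own. *)
Definition trace_prod (x y : L) : K := - trace_form x y.

Fact trace_prod_bilinear :
  bilinear_for (GRing.Scale.Law.clone _ _ *%R _)
    (GRing.Scale.Law.clone _ _ (idfun \; *%R) _) trace_prod.
Proof.
split=> z k x y; rewrite /trace_prod /trace_form /= linearP.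
  by rewrite mulmxDl -scalemxAl linearP /= opprD mulrN.
by rewrite mulmxDr -scalemxAr linearP /= opprD mulrN.
Qed.
HB.instance Definition _ := bilinear_isBilinear.Build K L L K
  (GRing.Scale.Law.clone _ _ *%R _)
  (GRing.Scale.Law.clone _ _ (idfun \; *%R) _) trace_prod trace_prod_bilinear.

Fact trace_prod_sym x y : trace_prod x y = (-1) ^+ false * idfun (trace_prod y x).
Proof. by rewrite mul1r /= /trace_prod /trace_form mxtrace_mulC. Qed.
HB.instance Definition _ :=
  isHermitianSesquilinear.Build K L false idfun trace_prod trace_prod_sym.

End TraceForm.

(** * Roots *)

(** The linear functionals on a subspace [t] of [L] are the elements of
    ['Hom(subvs_of t, K^o)]; [wt alpha h] is the value of [alpha] at a vector
    [h : L], meaningful only for [h \in t]. *)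
Section Roots.
Variables (K : fieldType) (L : lieAlgebraType K) (t : {vspace L}).
Implicit Types (alpha : 'Hom(subvs_of t, K^o)).

Definition wt alpha (h : L) : K := alpha (vsproj t h).

Definition root_space alpha : set L :=
  [set x | forall h, h \in t -> lie h x = wt alpha h *: x].

Definition root_system : set 'Hom(subvs_of t, K^o) :=
  [set alpha | alpha != 0 /\ exists2 x, x != 0 & root_space alpha x].

Definition nat_comb (pi : seq 'Hom(subvs_of t, K^o)) alpha : Prop :=
  exists n : 'Hom(subvs_of t, K^o) -> nat,
    alpha = \sum_(gamma <- pi) gamma *+ n gamma.

(** Since [pi] is free, at most one of the two alternatives holds. *)
Definition simple_roots (pi : seq 'Hom(subvs_of t, K^o)) : Prop :=
  [/\ free pi, [set` pi] `<=` root_system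
    & forall alpha, root_system alpha ->
        nat_comb pi alpha \/ nat_comb pi (- alpha)].

Definition positive_roots (pi : seq 'Hom(subvs_of t, K^o)) :=
  root_system `&` nat_comb pi.

(** Weyl basis modulo [t] (Helgason, Ch. III, Th. 5.5, stated there for the
    Killing form): [E_alpha, E_(-alpha)] is the vector [H_alpha] of [t] with
    [B h H_alpha = alpha h]. For the relation to a compact form, [B] must be
    negative definite on it: it is the form Phi_chi itself, not the scalar
    product [- Phi_chi]. *)
Definition weyl_basis (B : L -> L -> K)
    (E : 'Hom(subvs_of t, K^o) -> L) : Prop :=
  [/\ forall alpha, root_system alpha -> root_space alpha (E alpha),
      forall alpha, root_system alpha ->
        lie (E alpha) (E (- alpha)) \in t /\
        forall h, h \in t -> B h (lie (E alpha) (E (- alpha))) = wt alpha h,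
      forall alpha beta, root_system alpha -> root_system beta ->
        alpha + beta != 0 -> ~ root_system (alpha + beta) ->
        lie (E alpha) (E beta) = 0
    & exists2 N : 'Hom(subvs_of t, K^o) -> 'Hom(subvs_of t, K^o) -> K,
      forall alpha beta, root_system alpha -> root_system beta ->
        root_system (alpha + beta) ->
        lie (E alpha) (E beta) = N alpha beta *: E (alpha + beta)
    & forall alpha beta, root_system alpha -> root_system beta ->
        root_system (alpha + beta) ->
        N alpha beta = - N (- alpha) (- beta)].

End Roots.
Arguments root_system {K L} t.

(** * Complexification *)

(** The pair [(x, y)] stands for [x + i y]. *)
Definition complexification (R : rcfType) (V : vectType R) : Type :=
  (V * V)%type.

Section ComplexifiedVector.
Variables (R : rcfType) (V : vectType R).
Local Notation VC := (complexification V).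
Local Notation C := R[i].

HB.instance Definition _ := GRing.Zmodule.copy VC (V * V)%type.

Definition scaleC (k : C) (z : VC) : VC :=
  (complex.Re k *: z.1 - complex.Im k *: z.2,
   complex.Im k *: z.1 + complex.Re k *: z.2).

Fact scaleCA k l z : scaleC k (scaleC l z) = scaleC (k * l) z.
Proof.
case: k l z => [a b] [c d] [x y]; rewrite /scaleC /=.
rewrite !scalerBr !scalerDr !scalerBl !scalerDl !scalerA.
congr (_, _); first by rewrite !opprD addrACA.
by rewrite addrACA; congr (_ + _); rewrite addrC.
Qed.
Fact scaleC1 : left_id 1 scaleC.
Proof. by case=> x y; rewrite /scaleC /= !scale1r !scale0r subr0 add0r. Qed.
Fact scaleCDr : right_distributive scaleC +%R.
Proof.
case=> [a b] [x y] [z w]; rewrite /scaleC /= !scalerDr opprD.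
by congr (_, _); rewrite addrACA.
Qed.
Fact scaleCDl z : {morph scaleC^~ z : k l / k + l}.
Proof.
case: z => x y [a b] [c d]; rewrite /scaleC /= !scalerDl opprD.
by congr (_, _); rewrite addrACA.
Qed.

HB.instance Definition _ :=
  GRing.Zmodule_isLmodule.Build C VC scaleCA scaleC1 scaleCDr scaleCDl.

Fact complexification_vect_iso : Vector.axiom (\dim {:V}) VC.
Proof.
pose e := vbasis {:V}; have fr : free e := basis_free (vbasisP _).
exists (fun z => \row_i (coord e i z.1 +i* coord e i z.2)%C).
  move=> [a b] [x y] [z w]; apply/rowP => i; rewrite !mxE /=.
  rewrite !(linearB, linearD, linearZ) /=; apply/eqP.
  by rewrite eq_complex /= [b * _ + _]addrC !eqxx.
exists (fun r : 'rV[C]_(\dim {:V}) =>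
    (\sum_i complex.Re (r 0 i) *: e`_i, \sum_i complex.Im (r 0 i) *: e`_i)).
  move=> [x y]; rewrite [in RHS](coord_vbasis (memvf x)).
  rewrite [in RHS](coord_vbasis (memvf y)).
  by congr pair; apply: eq_bigr => i _; rewrite mxE.
move=> r; apply/rowP => i; rewrite mxE /= !coord_sum_free //.
by case: (r 0 i).
Qed.

HB.instance Definition _ :=
  Lmodule_hasFinDim.Build C VC complexification_vect_iso.

Definition toC (x : V) : VC := (x, 0).

Definition complexifyv (U : {vspace V}) : {vspace VC} :=
  <<[seq toC u | u <- vbasis U]>>%VS.

Lemma mem_complexifyv U z : z \in complexifyv U <-> z.1 \in U /\ z.2 \in U.
Proof.
split=> [|[]]; last first.
  case: z => x y /= xU yU; have toCin u : u \in U -> toC u \in complexifyv U.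
    move=> uU; rewrite (coord_vbasis uU).
    have -> : toC (\sum_i coord (vbasis U) i u *: (vbasis U)`_i) =
        \sum_i (coord (vbasis U) i u)%:C%C *: toC (vbasis U)`_i.
      have toCD (v w : V) : toC (v + w) = toC v + toC w.
        by congr (_, _); rewrite addr0.
      have toC_sum n (F : 'I_n -> V) : toC (\sum_i F i) = \sum_i toC (F i).
        by apply: (big_morph toC) => //.
      rewrite toC_sum; apply: eq_bigr => i _.
      rewrite [in RHS]/GRing.scale /= /scaleC /= scale0r !scaler0 scale0r subr0.
      by rewrite addr0.
    apply: memv_suml => i _; apply: memvZ; apply: memv_span.
    by apply: map_f; apply: mem_nth; rewrite size_tuple.
  have -> : (x, y) = toC x + 'i%C *: toC y :> VC.
    rewrite [in RHS]/GRing.scale /= /scaleC /= scale0r scaler0 scale1r subrr.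
    by congr (_, _); rewrite ?addr0 ?add0r // scaler0 addr0.
  by rewrite memvD ?memvZ ?toCin.
move/coord_span => ->.
elim/big_ind: _ => [|u v [u1 u2] [v1 v2]|i _]; first by rewrite !mem0v.
  by rewrite !memvD.
rewrite (nth_map 0) ?size_tuple ?ltn_ord //.
have uU : (vbasis U)`_i \in U by rewrite vbasis_mem ?mem_nth ?size_tuple.
rewrite /GRing.scale /= /scaleC /= !scaler0 subr0 addr0.
by rewrite !memvZ.
Qed.

(** The complex bilinear extension of a real bilinear form. *)
Definition complexify_form (B : V -> V -> R) (z w : VC) : C :=
  ((B z.1 w.1 - B z.2 w.2) +i* (B z.1 w.2 + B z.2 w.1))%C.

End ComplexifiedVector.

Section ComplexifiedLie.
Variables (R : rcfType) (L : lieAlgebraType R).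
Local Notation LC := (complexification L).
Implicit Types (z w : LC).

Definition lieC z w : LC :=
  (lie z.1 w.1 - lie z.2 w.2, lie z.1 w.2 + lie z.2 w.1).

Fact lieC_anti z w : lieC z w = - lieC w z.
Proof.
case: z w => [x y] [u v]; rewrite /lieC /= (lie_anti x u) (lie_anti y v).
rewrite (lie_anti x v) (lie_anti y u) -!opprD.
by congr (_, _); congr (- _); rewrite addrC.
Qed.

Fact lieCxx z : lieC z z = 0.
Proof.
case: z => x y; rewrite /lieC /= !liexx subr0.
by congr (_, _); rewrite (lie_anti y x) subrr.
Qed.

Fact lieC_linearr z : linear (lieC z).
Proof.
case: z => x y [a b] [z w] [u v]; rewrite /lieC /=.
rewrite [in RHS]/GRing.scale /= /scaleC /=.
rewrite !(linearB, linearD, linearZ) /= ?(scalerN, scalerBr, scalerDr, opprD).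
congr (_, _).
  rewrite addrACA; congr (_ + _).
  by rewrite [- (b *: _) - _]addrC addrACA.
rewrite addrACA; congr (_ + _).
by rewrite [a *: _ - _]addrC addrACA.
Qed.

Fact lieC_linearl w : linear (lieC^~ w).
Proof.
move=> k u v /=; rewrite !(lieC_anti _ w) lieC_linearr opprD.
by rewrite scalerN.
Qed.

Fact lieC_jacobi x y z :
  lieC x (lieC y z) + lieC y (lieC z x) + lieC z (lieC x y) = 0.
Proof.
case: x y z => [x x'] [y y'] [z z'].
have eq0 (u : L) : (forall i, coord (vbasis {:L}) i u = 0) -> u = 0.
  move=> u0; rewrite (coord_vbasis (memvf u)).
  by apply: big1 => i _; rewrite u0 scale0r.
have J a b c i : coord (vbasis {:L}) i (lie a (lie b c))
    + coord (vbasis {:L}) i (lie b (lie c a))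
    + coord (vbasis {:L}) i (lie c (lie a b)) = 0.
  by rewrite -!linearD lie_jacobi linear0.
congr (_, _) => /=; apply: eq0 => i; rewrite !(linearB, linearD) /=.
  by move: (J x y z i) (J x y' z' i) (J x' y z' i) (J x' y' z i); lra.
by move: (J x' y z i) (J x y' z i) (J x y z' i) (J x' y' z' i); lra.
Qed.

HB.instance Definition _ :=
  isLieAlgebra.Build R[i] LC lieC_linearl lieC_linearr lieCxx lieC_jacobi.

End ComplexifiedLie.

(** * Sets attached to a compact real form *)

Section RealForm.
Variables (R : rcfType) (L : lieAlgebraType R).

(** [E] is adapted to the real form [L]: [L] is spanned over the reals by [t]
    and the vectors [E_alpha - E_(-alpha)] and [i (E_alpha + E_(-alpha))]. *)
Definition adapted_to_real_form (t : {vspace L})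
    (E : 'Hom(subvs_of (complexifyv t), R[i]^o) -> complexification L) : Prop :=
  range (@toC R L) =
  [set z : complexification L | exists h (r s : 'Hom(subvs_of (complexifyv t), R[i]^o) -> R),
     h \in t /\
     z = toC h + \sum_(alpha \in root_system (complexifyv t))
       ((r alpha)%:C%C *: (E alpha - E (- alpha)) +
        (s alpha)%:C%C *: ('i%C *: (E alpha + E (- alpha))))].

(** [R(m)], where [k] is the centralizer of the fixed element. *)
Definition regular_set (k m : {vspace L}) : set L :=
  [set x | [/\ x \in m,
     \dim (lie_cent x) = min_dim m (@lie_cent R L)
   & \dim (lie_cent x :&: k) = min_dim m (fun y => lie_cent y :&: k)%VS]].

(** [M_a(m)]; the dimension on the left is over [R[i]]. *)
Definition uniform_set (a : L) (m : {vspace L}) : set L :=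
  [set x | x \in m /\ forall lambda : R[i],
     \dim (lie_cent (toC x + lambda *: toC a)) = min_dim m (@lie_cent R L)].

End RealForm.

(* Main.v *)
Require Import Defs.
From HB Require Import structures.
From mathcomp Require Import all_boot all_order all_algebra all_field.
From mathcomp Require Import boolp classical_sets functions cardinality fsbigop.
From mathcomp Require Import reals.
From mathcomp Require Import complex.
From mathcomp Require Import mpoly ring zify.

(** Work in coordinates over fields [F] containing the complex numbers, and let [r]
    be the dimension of the centraliser of a point of [R(m)] lying in [m~].

    If no [x] in [m~] were as required, then for the generic point [x] of [m~] there
    would be an algebraic function [lambda] of [x], with values in an extension of the
    field of rational functions, such that [y = x + lambda a] has a centraliser of
    dimension larger than [r], hence at least [r + 2] since [ad y] has even rank.
    The partial derivatives extend to this field and send [y] to the vectors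
    [e_i + (d lambda / d x_i) a], where [e_i] is the basis of [m~].  Triangularising
    commuting matrices shows that, as functionals on these vectors, all elements of the
    centraliser of [y] are combinations of the gradients of the invariants
    [tr (y ^+ k)].  On the other hand an element of the centraliser of [x + l a]
    orthogonal to [m~] and to [a] moves linearly with [l], so that the number [c] of
    such elements is the same for all [l <> 0].  For generic [l] the gradients span at
    most [r - c] functionals on [m~ + F a], hence also for [l = lambda]; but the
    centraliser of [y] gives at least [r + 2 - c] of them, and passing from [m~ + F a]
    to the vectors above loses at most one.

    That no centraliser has dimension less than [r] is obtained similarly: at the
    generic point of [m] the gradients supply [r - dim z(g)] functionals on [m], because
    [k^x = z(g)]; hence they do so at a generic point of [g], where the centre accounts
    for the remaining part of the centraliser. *)

Set Implicit Arguments.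
Unset Strict Implicit.
Unset Printing Implicit Defensive.
Import GRing.Theory Num.Theory.

Local Open Scope ring_scope.

(** * Simultaneous triangularisation *)

Section Cotrigonalization.
Variable F : fieldType.

(** A product of linear factors that kills [A], listed by its roots; the factors act on rows one at
    a time, which also makes sense for matrices of size 0. *)
Definition annihilated_by n (A : 'M[F]_n) (s : seq F) : Prop :=
  forall w : 'rV_n, foldl (fun w c => w *m (A - c%:M)) w s = 0.

(** The factors [A - c] are applied to [w] in turn; the last nonzero vector obtained is an
    eigenvector, and it stays in [E] by stability. *)
Lemma annihilated_eigenvector n (A E : 'M[F]_n) s (w : 'rV_n) :
    annihilated_by A s -> w != 0 -> (w <= E)%MS -> stablemx E A ->
  exists (v : 'rV_n) c, [/\ v != 0, (v <= E)%MS & v *m A = c *: v].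
Proof.
move=> /(_ w) + w0 wE EA; elim: s w w0 wE => [|c s IHs] w w0 wE /=.
  by move=> w00; rewrite w00 eqxx in w0.
have [wA0 _|wA0 sA] := eqVneq (w *m (A - c%:M)) 0.
  exists w, c; split=> //; apply/eqP; rewrite -subr_eq0 -mul_mx_scalar.
  by rewrite -mulmxBr wA0.
apply: IHs wA0 _ sA; rewrite mulmxBr mul_mx_scalar addmx_sub ?eqmx_opp //.
  exact: submx_trans (submxMr A wE) EA.
by rewrite scalemx_sub.
Qed.

(** An eigenspace of [A] is stable under the commuting [B], so [B] has an eigenvector in it. *)
Lemma common_eigenvector n (A B : 'M[F]_n.+1) s t :
    A *m B = B *m A -> annihilated_by A s -> annihilated_by B t ->
  exists (v : 'rV_n.+1) a b, [/\ v != 0, v *m A = a *: v & v *m B = b *: v].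
Proof.
move=> cAB sA tB.
have n10 : (const_mx 1 : 'rV[F]_n.+1) != 0.
  by apply/eqP => /rowP/(_ 0); rewrite !mxE => /eqP; rewrite oner_eq0.
have [|v [a [v0 _ vA]]] := annihilated_eigenvector sA n10 (submx1 _).
  exact: submx1.
have vE : (v <= eigenspace A a)%MS by apply/eigenspaceP.
have [|u [b [u0 uE uB]]] := annihilated_eigenvector tB v0 vE.
  apply: comm_mx_stable_eigenspace; exact: esym.
by exists u, a, b; split=> //; apply/eigenspaceP.
Qed.

(** Induction on the size: in a basis beginning with a common eigenvector both matrices are block
    triangular, and the lower right blocks again commute and are annihilated by the same lists. *)
Lemma cotrigonalization n (A B : 'M[F]_n) s t :
    A *m B = B *m A -> annihilated_by A s -> annihilated_by B t ->
  exists2 P : 'M_n, P \in unitmx &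
    is_trig_mx (P *m A *m invmx P) /\ is_trig_mx (P *m B *m invmx P).
Proof.
elim: n A B => [|n IHn] A B cAB sA tB.
  exists 1%:M; first exact: unitmx1.
  by split; apply/is_trig_mxP => - [].
have [v [a [b [v0 vA vB]]]] := common_eigenvector cAB sA tB.
(* [row_ebase] completes [v] to a basis: its first row is [v] up to a nonzero factor. *)
pose Q : 'M_(1 + n) := row_ebase v; have Qu : Q \in unitmx by apply: row_ebase_unit.
have [k k0 vQ] : exists2 k, k != 0 & v = k *: row 0 Q.
  have := mulmx_ebase v; have -> : \rank v = 1%N by rewrite rank_rV v0.
  set C := col_ebase v; have -> : C = (C 0 0)%:M by apply: mx11_scalar.
  rewrite -mulmxA mul_scalar_mx => vE; exists (C 0 0).
    by apply: contraNneq v0 => C0; rewrite -vE C0 scale0r.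
  rewrite -{1}vE; congr (_ *: _); rewrite rowE; congr (_ *m _).
  by apply/rowP => j; rewrite !mxE /= ltnS leqn0 andbC eq_sym; case: eqP.
have blockE (M : 'M_n.+1) m (vM : v *m M = m *: v) :
  exists c, exists M', Q *m M *m invmx Q = block_mx (m%:M : 'M_1) 0 c M'.
  exists (dlsubmx (Q *m M *m invmx Q : 'M_(1 + n))).
  exists (drsubmx (Q *m M *m invmx Q : 'M_(1 + n))).
  rewrite -[LHS](@submxK _ 1 n 1 n).
  have r0 : row 0 (Q *m M *m invmx Q) = m *: delta_mx 0 0.
    have rQ : row 0 Q = k^-1 *: v by rewrite vQ scalerA mulVf // scale1r.
    rewrite !row_mul rQ -!scalemxAl vM -scalemxAl scalerA mulrC -scalerA.
    by rewrite scalemxAl -rQ -row_mul mulmxV // row1.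
  congr block_mx; apply/matrixP => i j; rewrite ord1 !mxE.
    have := congr1 (fun x : 'rV_(1 + n) => x 0 (lshift n j)) r0.
    rewrite !mxE lshift0 ord1 eqxx mulr1 => <-.
    by congr (\sum_(_ < _) (_ * _)); apply/val_inj.
  have := congr1 (fun x : 'rV_(1 + n) => x 0 (rshift 1 j)) r0.
  by rewrite !mxE lshift0 /= mulr0.
have [cA [A' EA]] := blockE A a vA; have [cB [B' EB]] := blockE B b vB.
have conjM (M N : 'M_n.+1) :
    (Q *m M *m invmx Q) *m (Q *m N *m invmx Q) = Q *m (M *m N) *m invmx Q.
  by rewrite !mulmxA mulmxKV.
have cAB' : A' *m B' = B' *m A'.
  have : (Q *m A *m invmx Q) *m (Q *m B *m invmx Q)
      = (Q *m B *m invmx Q) *m (Q *m A *m invmx Q) by rewrite !conjM cAB.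
  rewrite EA EB !(mulmx_block a%:M) !(mulmx_block b%:M).
  by move=> /eq_block_mx[_ _ _]; rewrite !mulmx0 !add0r.
(* The last [n] coordinates of a row are transformed by [M'] alone, because the upper right block
   vanishes. *)
have annih (M : 'M_n.+1) m c M' r :
    Q *m M *m invmx Q = block_mx (m%:M : 'M_1) 0 c M' -> annihilated_by M r ->
    annihilated_by M' r.
  move=> EM rM w; pose x : 'rV_(1 + n) := row_mx 0 w.
  have := congr1 (fun z : 'rV_n.+1 => rsubmx (z *m invmx Q : 'rV_(1 + n))) (rM (x *m Q)).
  rewrite mul0mx linear0 => <-.
  have : rsubmx (x *m Q *m invmx Q : 'rV_(1 + n)) = w by rewrite mulmxK // row_mxKr.
  move: (x *m Q) => {x rM} y; elim: r y w => [|e r IHr] x w xw //=.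
  apply: IHr.
  rewrite -xw -[in LHS](mulmxKV Qu x) -[LHS]/(rsubmx (_ : 'rV_(1 + n))).
  have -> : x *m invmx Q *m Q *m (M - e%:M) *m invmx Q
      = x *m invmx Q *m (block_mx (m%:M : 'M_1) 0 c M' - e%:M).
    rewrite -EM -!mulmxA; congr (_ *m _); congr (_ *m _).
    rewrite !mulmxA mulmxBr mulmxBl; congr (_ - _).
    by rewrite mul_mx_scalar -scalemxAl mulmxV // scalemx1.
  set z := x *m invmx Q; rewrite -[z in LHS](@hsubmxK _ 1 1 n) mulmxBr.
  rewrite mul_row_block linearB /= row_mxKr mulmx0 add0r mul_mx_scalar.
  by rewrite linearZ /= row_mxKr mulmxBr mul_mx_scalar.
have [P Pu [PA PB]] := IHn A' B' cAB' (annih _ _ _ _ _ EA sA) (annih _ _ _ _ _ EB tB).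
pose P1 : 'M_(1 + n) := block_mx 1%:M 0 0 P.
have P1u : P1 \in unitmx by rewrite unitmxE det_ublock det1 mul1r -unitmxE.
have P1V : invmx P1 = block_mx (1%:M : 'M_1) 0 0 (invmx P).
  apply: (can_inj (mulKmx P1u)); rewrite mulmxV // /P1.
  rewrite (mulmx_block 1%:M) !mulmx0 !mul0mx !mulmx1 !addr0 !add0r mulmxV //.
  by rewrite scalar_mx_block.
exists (P1 *m Q); first by rewrite unitmx_mul P1u.
have trig M m c M' : Q *m M *m invmx Q = block_mx (m%:M : 'M_1) 0 c M' ->
    is_trig_mx (P *m M' *m invmx P) -> is_trig_mx (P1 *m Q *m M *m invmx (P1 *m Q)).
  move=> EM PM; have -> : invmx (P1 *m Q) = invmx Q *m invmx P1.
    have PQu : P1 *m Q \in unitmx by rewrite unitmx_mul P1u.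
    apply: (can_inj (mulKmx PQu)); rewrite mulmxV // mulmxA mulmxK //.
    by rewrite mulmxV.
  have -> : P1 *m Q *m M *m (invmx Q *m invmx P1)
      = P1 *m (Q *m M *m invmx Q) *m invmx P1 by rewrite !mulmxA.
  rewrite EM P1V !(mulmx_block 1%:M) (mulmx_block (1%:M *m m%:M + 0 *m c)).
  rewrite !mulmx0 !mul0mx !mulmx1 !mul1mx !addr0 !add0r.
  by rewrite is_trig_block_mx // mx11_is_trig mul0mx eqxx.
by split; [apply: trig EA PA | apply: trig EB PB].
Qed.
End Cotrigonalization.

(** * Derivations and traces *)

Section TriangularDiagonal.
Variables (F : fieldType) (n : nat).
Implicit Types A B : 'M[F]_n.

Lemma trig_mulmx A B : is_trig_mx A -> is_trig_mx B -> is_trig_mx (A *m B).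
Proof.
move=> /is_trig_mxP tA /is_trig_mxP tB; apply/is_trig_mxP => i j ij.
rewrite mxE big1 // => k _; have [ki|ik] := leqP k i.
  by rewrite (tB k j) ?mulr0 // (leq_ltn_trans ki).
by rewrite tA // mul0r.
Qed.

Lemma trig_mulmx_diag A B i : is_trig_mx A -> is_trig_mx B ->
  (A *m B) i i = A i i * B i i.
Proof.
move=> /is_trig_mxP tA /is_trig_mxP tB; rewrite mxE (bigD1 i) //=.
rewrite [X in _ + X]big1 ?addr0 // => k; rewrite neq_ltn => /orP[ki|ik].
  by rewrite (tB k i) ?mulr0.
by rewrite tA // mul0r.
Qed.

Lemma trig_expmx A k : is_trig_mx A -> is_trig_mx (A ^+ k).
Proof.
move=> tA; elim: k => [|k IHk]; first by rewrite expr0 scalar_mx_is_trig.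
by rewrite exprS; apply: trig_mulmx.
Qed.

Lemma trig_expmx_diag A k i : is_trig_mx A -> (A ^+ k) i i = A i i ^+ k.
Proof.
move=> tA; elim: k => [|k IHk]; first by rewrite !expr0 mxE eqxx.
by rewrite !exprS [LHS]trig_mulmx_diag ?IHk //; apply: trig_expmx.
Qed.
End TriangularDiagonal.

Definition derivation (R : pzRingType) (D : R -> R) : Prop :=
  (forall x y, D (x + y) = D x + D y) /\
  (forall x y, D (x * y) = D x * y + x * D y).

Section Derivation.
Variables (R : pzRingType) (D : R -> R).
Hypothesis derD : derivation D.

Lemma derivation0 : D 0 = 0.
Proof. by apply: (addrI (D 0)); rewrite -derD.1 !addr0. Qed.

Lemma derivation1 : D 1 = 0.
Proof. by apply: (addrI (D 1)); rewrite addr0 -{3}[1]mulr1 derD.2 mulr1 mul1r. Qed.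

Lemma derivation_sum (I : Type) (r : seq I) (P : pred I) (f : I -> R) :
  D (\sum_(i <- r | P i) f i) = \sum_(i <- r | P i) D (f i).
Proof. exact: (big_morph D derD.1 derivation0). Qed.

Lemma derivation_mulmx m n p (A : 'M[R]_(m, n)) (B : 'M_(n, p)) :
  map_mx D (A *m B) = map_mx D A *m B + A *m map_mx D B.
Proof.
apply/matrixP => i j; rewrite !mxE derivation_sum -big_split /=.
by apply: eq_bigr => k _; rewrite !mxE derD.2.
Qed.
End Derivation.

Section TraceDerivation.
Variables (F : fieldType) (D : F -> F).
Hypothesis derD : derivation D.

(** [A] is a conjugate of the triangular [T]. In [map_mx D A] the two terms containing [map_mx D P]
    have the same trace against [U], as [U] commutes with [A]; what remains is the trace of a
    product of two triangular matrices. *)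
Lemma mxtrace_mul_derivation n (P A U : 'M[F]_n) :
    P \in unitmx -> A *m U = U *m A ->
    is_trig_mx (P *m A *m invmx P) -> is_trig_mx (P *m U *m invmx P) ->
  \tr (U *m map_mx D A) =
  \sum_i (P *m U *m invmx P) i i * D ((P *m A *m invmx P) i i).
Proof.
move=> Pu cAU /is_trig_mxP tA /is_trig_mxP tU.
set T := P *m A *m invmx P in tA *; set V := P *m U *m invmx P in tU *.
have DA : map_mx D A
    = invmx P *m (map_mx D T *m P + T *m map_mx D P - map_mx D P *m A).
  rewrite -(derivation_mulmx derD) mulmxKV // (derivation_mulmx derD).
  by rewrite addrC addKr mulKmx.
rewrite {}DA !mulmxBr !mulmxDr !linearB !linearD /=.
have -> : \tr (U *m (invmx P *m (T *m map_mx D P)))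
    = \tr (U *m (invmx P *m (map_mx D P *m A))).
  rewrite /T !mulmxA mulmxKV // [RHS]mxtrace_mulC -cAU !mulmxA.
  by [].
rewrite addrK !mulmxA mxtrace_mulC !mulmxA -/V /mxtrace; apply: eq_bigr => i _.
rewrite mxE (bigD1 i) //= [X in _ + X]big1 ?addr0 => [|j].
  by congr (_ * _); rewrite mxE.
rewrite neq_ltn => /orP[ji|ij]; last by rewrite tU // mul0r.
by rewrite [map_mx _ _ _ _]mxE tA // derivation0 // mulr0.
Qed.

(** A Vandermonde argument with repeated nodes: the sums are tested on a polynomial vanishing at all
    nodes other than [theta i], which leaves a nonzero multiple of [delta i]. *)
Lemma power_sums_eq0 n (theta delta : 'I_n -> F) :
    (forall k, k.+1%:R != 0 :> F) ->
    (forall i j, theta i = theta j -> delta i = delta j) ->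
    (forall k, (k < n)%N -> \sum_i theta i ^+ k * delta i = 0) ->
  forall i, delta i = 0.
Proof.
move=> char0 td sum0 i.
pose q := \prod_(j | theta j != theta i) ('X - (theta j)%:P).
have qi : q.[theta i] != 0.
  rewrite horner_prod; apply/prodf_neq0 => j ji.
  by rewrite !hornerE subr_eq0 eq_sym.
(* The index [i] itself is left out of the product, so the degree is below [n]. *)
have sq : (size q <= n)%N.
  rewrite /q -big_filter size_prod_XsubC -cardE -[leqRHS](card_ord n).
  apply: proper_card; apply/properP; split; first exact/fintype.subsetP.
  by exists i; rewrite // unfold_in /= eqxx.
have : \sum_j q.[theta j] * delta j = 0.
  under eq_bigr => j _ do rewrite (horner_coef_wide _ sq) mulr_suml.
  rewrite exchange_big /= big1 // => k _.
  under eq_bigr => j _ do rewrite -mulrA.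
  by rewrite -mulr_sumr sum0 ?mulr0.
rewrite (bigID (fun j => theta j == theta i)) /= [X in _ + X]big1 ?addr0; last first.
  by move=> j ji; rewrite /q horner_prod (bigD1 j) //= !hornerE subrr !mul0r.
under eq_bigr => j /eqP ji do rewrite ji (td _ _ ji).
rewrite sumr_const -mulr_natr => /eqP; rewrite !mulf_eq0 (negPf qi) /=.
have : (0 < #|[pred j | theta j == theta i]|)%N.
  by apply/card_gt0P; exists i; rewrite inE.
by case: #|_| => // m _; rewrite (negPf (char0 m)) orbF => /eqP.
Qed.

(** After simultaneous triangularisation the hypotheses concern power sums of the diagonal entries
    of [A], weighted by the derivatives of these entries; hence all these derivatives vanish. *)
Lemma mxtrace_derivation_split n (A U : 'M[F]_n) s t :
    (forall k, k.+1%:R != 0 :> F) -> A *m U = U *m A ->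
    annihilated_by A s -> annihilated_by U t ->
    (forall k, (k < n)%N -> \tr (A ^+ k *m map_mx D A) = 0) ->
  \tr (U *m map_mx D A) = 0.
Proof.
move=> char0 cAU sA tU tr0.
have [P Pu [PA PU]] := cotrigonalization cAU sA tU.
have conjX k : P *m A ^+ k *m invmx P = (P *m A *m invmx P) ^+ k.
  elim: k => [|k IHk]; first by rewrite !expr0 mulmx1 mulmxV.
  by rewrite !exprS -IHk -!mulmxE !mulmxA mulmxKV.
rewrite (mxtrace_mul_derivation Pu) // big1 // => i _.
pose th i := (P *m A *m invmx P) i i.
rewrite (@power_sums_eq0 n th (D \o th) _ _ _ i : D (th i) = 0) ?mulr0 // => {i}.
  by move=> i j; rewrite /= => ->.
move=> k kn; rewrite -[RHS](tr0 k kn) (mxtrace_mul_derivation Pu) //.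
- by apply: eq_bigr => j _; rewrite conjX trig_expmx_diag.
- by rewrite mulmxE -exprS exprSr.
- by rewrite conjX trig_expmx.
Qed.
End TraceDerivation.

(** * Field extensions to which derivations extend *)

Lemma derivation_map_poly (R : nzRingType) (D : R -> R) :
  derivation D -> derivation (map_poly D : {poly R} -> {poly R}).
Proof.
move=> derD; have D0 := derivation0 derD; split=> p q; apply/polyP => i.
  by rewrite coefD !coef_map_id0 // coefD derD.1.
rewrite coefD coef_map_id0 // !coefM derivation_sum // -big_split /=.
by apply: eq_bigr => j _; rewrite derD.2 !coef_map_id0.
Qed.

Lemma exists_irreducible_factor (F : fieldType) (p : {poly F}) :
  (1 < size p)%N -> exists2 q, irreducible_poly q & q %| p.
Proof.
have [m] := ubnP (size p); elim: m p => // m IHm p; rewrite ltnS => pm p1.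
have [irr_p|/not_andP[//|]] := pselect (irreducible_poly p).
  by exists p.
move=> /existsNP[q] /not_implyP[q1] /not_implyP[qp] /negP; rewrite /eqp qp /=.
move=> pq; have p0 : p != 0 by rewrite -size_poly_gt0 ltnW.
have q0 : q != 0 by apply: contraNneq p0 => q0; rewrite -dvd0p -q0.
have [||r irr_r rq] := IHm q.
- rewrite (leq_trans _ pm) // ltn_neqAle (dvdp_leq p0 qp) andbT.
  by rewrite dvdp_size_eqp //; apply: contra pq => /andP[].
- by rewrite ltn_neqAle eq_sym q1 size_poly_gt0.
by exists r => //; apply: dvdp_trans rq qp.
Qed.

(** Stands in for being algebraic over a field of characteristic zero; it is closed under
    composition, so roots can be adjoined one by one. *)
Definition extends_derivations (F L : fieldType) (f : {rmorphism F -> L}) : Prop :=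
  forall D, derivation D -> exists2 D', derivation D' & forall x, D' (f x) = f (D x).

Lemma root_irreducible_dvdp (F L : fieldType) (f : {rmorphism F -> L}) p q (z : L) :
    irreducible_poly p -> root (map_poly f p) z ->
  root (map_poly f q) z -> p %| q.
Proof.
move=> irr_p pz qz; have gz : root (map_poly f (gcdp p q)) z.
  by rewrite gcdp_map root_gcd pz qz.
have /irr_p.2/(_ (dvdp_gcdl p q)) gp : size (gcdp p q) != 1%N.
  apply: contraTN gz => /eqP/eq_leq/size1_polyC gE.
  rewrite gE map_polyC rootC fmorph_eq0 -polyC_eq0 -gE gcdp_eq0.
  by rewrite (negPf (irredp_neq0 irr_p)).
by rewrite -(eqp_dvdl _ gp) dvdp_gcdr.
Qed.

(** The value at [z] of an extended derivation is forced by differentiating the equation of [z]; in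
    characteristic zero the derivative of an irreducible polynomial does not vanish at its roots. *)
Lemma adjoin_root (F : fieldType) (p : {poly F}) :
    (forall k, k.+1%:R != 0 :> F) -> (1 < size p)%N ->
  exists (L : fieldType) (f : {rmorphism F -> L}) (z : L),
    root (map_poly f p) z /\ extends_derivations f.
Proof.
move=> char0 /exists_irreducible_factor[q irr_q qp].
have [L _ [z qz Lz]] := irredp_FAdjoin irr_q.
pose f : {rmorphism F -> L} := GRing.in_alg L.
exists L, f, z; split.
  by move: qp => /dvdpP[r ->]; rewrite rmorphM rootM qz orbT.
have rep (l : L) : exists r : {poly F}, (map_poly f r).[z] == l.
  have : l \in <<1; z>>%VS by rewrite Lz memvf.
  move=> lz; have /polyOver1P[r rE] := Fadjoin_polyOver 1%AS z l.
  by exists r; rewrite -rE Fadjoin_poly_eq.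
pose pol l := xchoose (rep l).
have polK l : (map_poly f (pol l)).[z] = l by apply/eqP/(xchooseP (rep l)).
have q'z : (map_poly f q)^`().[z] != 0.
  apply/negP; rewrite deriv_map => q'z.
  have q1 : (1 < size q)%N := irr_q.1.
  have q'0 : q^`() != 0.
    apply: contraTneq isT => q'0.
    have : q^`()`_(size q).-2 = 0 by rewrite q'0 coef0.
    rewrite coef_deriv; case: (size q) q1 (lead_coefE q) => [|[|m]] //= _ lq.
    rewrite -lq -mulr_natr => /eqP; rewrite mulf_eq0 (negPf (char0 _)) orbF.
    by rewrite lead_coef_eq0 (negPf (irredp_neq0 irr_q)).
  have := dvdp_leq q'0 (root_irreducible_dvdp irr_q qz q'z).
  by rewrite leqNgt lt_size_deriv // irredp_neq0.
move=> D derD; have derDp := derivation_map_poly derD.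
(* [w] is the future derivative of [z], solved from the requirement [d q = 0]. *)
pose w := - (map_poly f (map_poly D q)).[z] / (map_poly f q)^`().[z].
pose d (r : {poly F}) := (map_poly f (map_poly D r)).[z] + (map_poly f r^`()).[z] * w.
have dD r s : d (r + s) = d r + d s.
  by rewrite /d derDp.1 derivD !rmorphD !hornerD /= mulrDl addrACA.
have dM r s : d (r * s) = d r * (map_poly f s).[z] + (map_poly f r).[z] * d s.
  rewrite /d derDp.2 derivM !rmorphD !rmorphM !hornerD !hornerM /=.
  rewrite !mulrDl !mulrDr mulrAC -!mulrA addrACA.
  by congr (_ + _ + (_ + _)); rewrite !mulrA // mulrAC.
have dq : d q = 0.
  by rewrite /d /w -deriv_map mulNr mulrN mulrC divfK ?subrr.
(* Since [d q = 0], [d] depends only on the value of the polynomial at [z], so the choice of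
   representatives [pol] is immaterial. *)
have dE r s : (map_poly f r).[z] = (map_poly f s).[z] -> d r = d s.
  move=> rs; have : q %| r - s.
    apply: root_irreducible_dvdp qz _ => //.
    by rewrite /root rmorphB hornerD hornerN rs subrr.
  move=> /dvdpP[e /(canRL (subrK s)) ->]; rewrite dD dM dq mulr0 addr0.
  by rewrite (eqP qz) mulr0 add0r.
exists (fun l => d (pol l)).
  split=> x y.
    by rewrite -dD; apply: dE; rewrite rmorphD hornerD !polK.
  rewrite -[X in _ * X + _](polK y) -[X in _ + X * _](polK x) -dM; apply: dE.
  by rewrite rmorphM hornerM !polK.
move=> x; rewrite (dE _ x%:P); last by rewrite polK map_polyC hornerC.
rewrite /d derivC rmorph0 horner0 mul0r addr0.
have -> : map_poly D x%:P = (D x)%:P.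
  apply/polyP => i; rewrite coef_map_id0 ?derivation0 // !coefC.
  by case: ifP => // _; apply: derivation0.
by rewrite map_polyC hornerC.
Qed.

Lemma split_poly (F : fieldType) (p : {poly F}) :
    (forall k, k.+1%:R != 0 :> F) -> p != 0 ->
  exists (L : fieldType) (f : {rmorphism F -> L}) (s : seq L) (c : L),
    map_poly f p = c *: \prod_(z <- s) ('X - z%:P) /\ extends_derivations f.
Proof.
have [m] := ubnP (size p); elim: m F p => // m IHm F p; rewrite ltnS => pm char0 p0.
have [p1|p1] := leqP (size p) 1.
  exists F, (@idfun F : {rmorphism F -> F}), [::], p`_0.
  split; last by move=> D derD; exists D.
  by rewrite map_poly_id // big_nil alg_polyC; apply: size1_polyC.
have [L [f [z [pz fD]]]] := adjoin_root char0 p1.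
have [q pE] := factor_theorem _ _ pz.
have q0 : q != 0 by apply: contraNneq p0 => q0; rewrite -(map_poly_eq0 f) pE q0 mul0r.
have charL k : k.+1%:R != 0 :> L by rewrite -(rmorph_nat f) fmorph_eq0.
have [|L' [f' [s [c [qE f'D]]]]] := IHm L q _ charL q0.
  rewrite (leq_trans _ pm) // -(size_map_poly f) pE size_Mmonic ?monicXsubC //.
  by rewrite size_XsubC addn2.
exists L', (f' \o f : {rmorphism F -> L'}), (f' z :: s), c; split.
  rewrite map_poly_comp /= pE rmorphM /= qE big_cons mulrC -scalerAr.
  by rewrite rmorphB /= map_polyX map_polyC.
move=> D /fD[D1 /f'D[D2 derD2 D21] D1D]; exists D2 => // x /=.
by rewrite D21 D1D.
Qed.

(** * Matrix Lie algebras in coordinates *)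

Lemma foldl_mulmx_horner (F : fieldType) n (A : 'M[F]_n.+1) s (w : 'rV_n.+1) :
  foldl (fun w c => w *m (A - c%:M)) w s
  = w *m horner_mx A (\prod_(c <- s) ('X - c%:P)).
Proof.
elim: s w => [|c s IHs] w /=; first by rewrite big_nil rmorph1 mulmx1.
rewrite IHs big_cons rmorphM /= -mulmxE mulmxA rmorphB /= horner_mx_X.
by rewrite horner_mx_C.
Qed.

(** Over a splitting field the commuting matrices [A] and [U] are triangularised
    simultaneously, with diagonals [theta] and [eta]; then the traces in the
    statement are [\sum_i theta i ^+ k * D (theta i)] and
    [\sum_i eta i * D (theta i)]. *)
Lemma mxtrace_derivation (F : fieldType) (D : F -> F) n (A U : 'M[F]_n) :
    derivation D -> (forall k, k.+1%:R != 0 :> F) -> A *m U = U *m A ->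
    (forall k, (k < n)%N -> \tr (A ^+ k *m map_mx D A) = 0) ->
  \tr (U *m map_mx D A) = 0.
Proof.
case: n A U => [|n] A U derD char0 cAU tr0; first by rewrite /mxtrace big_ord0.
have p0 : char_poly A * char_poly U != 0 by rewrite mulf_neq0 // monic_neq0 // char_poly_monic.
have [L [f [s [c [pE /(_ D derD)[D' derD' D'f]]]]]] := split_poly char0 p0.
have charL k : k.+1%:R != 0 :> L by rewrite -(rmorph_nat f) fmorph_eq0.
have c0 : c != 0.
  by apply: contra_neq p0 => c0; apply: (map_poly_inj f); rewrite pE c0 scale0r rmorph0.
have annih (M : 'M[F]_n.+1) :
    char_poly M %| char_poly A * char_poly U -> annihilated_by (map_mx f M) s.
  move=> /dvdpP[q qE] w; rewrite foldl_mulmx_horner.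
  have : horner_mx M (char_poly A * char_poly U) = 0.
    by rewrite qE rmorphM /= [X in _ * X]Cayley_Hamilton mulr0.
  move=> /(congr1 (map_mx f)); rewrite map_horner_mx pE map_mx0 linearZ /=.
  move=> /eqP; rewrite scaler_eq0 (negPf c0) /= => /eqP ->.
  by rewrite mulmx0.
apply/eqP; rewrite -(fmorph_eq0 f) -trace_map_mx map_mxM; apply/eqP.
have D'A : map_mx f (map_mx D A) = map_mx D' (map_mx f A).
  by apply/matrixP => i j; rewrite !mxE D'f.
rewrite D'A; apply: (mxtrace_derivation_split derD' charL (s := s) (t := s)).
- by rewrite -!map_mxM cAU.
- by apply: annih; rewrite dvdp_mulr.
- by apply: annih; rewrite dvdp_mull.
move=> k kn; rewrite -D'A -rmorphXn /= -map_mxM.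
by rewrite trace_map_mx tr0 // rmorph0.
Qed.

Section LinearCombination.
Variables (F : comNzRingType) (d m n : nat) (B : 'I_d -> 'M[F]_(m, n)).

Definition lincomb (c : 'rV[F]_d) : 'M[F]_(m, n) := \sum_i c 0 i *: B i.

Lemma lincomb_linear : linear lincomb.
Proof.
move=> k u v; rewrite /lincomb scaler_sumr -big_split; apply: eq_bigr => i _.
by rewrite !mxE scalerDl scalerA.
Qed.
HB.instance Definition _ :=
  GRing.isLinear.Build F 'rV[F]_d 'M[F]_(m, n) _ lincomb lincomb_linear.
End LinearCombination.

Section MatrixLieAlgebra.
Variables (F : fieldType) (n d : nat).
(** [B] is a basis of a Lie algebra of matrices, [S i] is the matrix of
    [ad (B i)] acting on rows of coordinates. *)
Variables (B : 'I_d -> 'M[F]_n) (S : 'I_d -> 'M[F]_d).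
Local Notation X := (lincomb B).
Local Notation adm := (lincomb S).

Definition gram : 'M[F]_d := \matrix_(i, j) \tr (B i *m B j).

(** Row [k] is, in dual coordinates, the differential at [z] of [\tr (X z ^+ k.+1)] divided by
    [k.+1]. *)
Definition power_traces (z : 'rV[F]_d) : 'M[F]_(n, d) :=
  \matrix_(k, j) \tr (X z ^+ k *m B j).

Lemma gramE (u v : 'rV[F]_d) : \tr (X u *m X v) = (u *m gram *m v^T) 0 0.
Proof.
transitivity (\sum_i \sum_j u 0 i * (gram i j * v 0 j)).
  rewrite /lincomb mulmx_suml linear_sum; apply: eq_bigr => i _ /=.
  rewrite mulmx_sumr linear_sum; apply: eq_bigr => j _ /=.
  by rewrite -scalemxAl -scalemxAr !linearZ /= [gram _ _]mxE [v 0 j * _]mulrC.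
rewrite exchange_big mxE; apply: eq_bigr => j _; rewrite !mxE mulr_suml.
by apply: eq_bigr => i _; rewrite mulrA.
Qed.

Lemma power_tracesE z N (W : 'M[F]_(N, d)) k i :
  (power_traces z *m W^T) k i = \tr (X z ^+ k *m X (row i W)).
Proof.
rewrite mxE /lincomb mulmx_sumr linear_sum; apply: eq_bigr => j _ /=.
by rewrite -scalemxAr linearZ /= !mxE mulrC.
Qed.

(** Inclusion of row spaces is tested on the columns of a cokernel. Such a column combines the [D i]
    into one derivation [DD] for which [map_mx DD (X y)] is trace orthogonal to the powers of [X y],
    hence, by [mxtrace_derivation], to every matrix commuting with [X y]. *)
Lemma commuting_sub_power_traces (y : 'rV[F]_d) N (W : 'M[F]_(N, d))
    (D : 'I_N -> F -> F) p (K : 'M[F]_(p, d)) :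
    (forall k, k.+1%:R != 0 :> F) -> (forall i, derivation (D i)) ->
    (forall i, map_mx (D i) (X y) = X (row i W)) ->
    (forall i, X y *m X (row i K) = X (row i K) *m X y) ->
  (K *m gram *m W^T <= power_traces y *m W^T)%MS.
Proof.
move=> char0 derD DW Kc; rewrite submxE; apply/eqP/matrixP => r c.
set C := cokermx _; rewrite [RHS]mxE.
pose DD x := \sum_i C i c * D i x.
have derDD : derivation DD.
  split=> x y'; rewrite /DD.
    by rewrite -big_split; apply: eq_bigr => i _; rewrite (derD i).1 mulrDr.
  rewrite mulr_suml mulr_sumr -big_split /=; apply: eq_bigr => i _ /=.
  by rewrite (derD i).2 mulrDr -mulrA [x * (_ * _)]mulrCA.
have DDy : map_mx DD (X y) = \sum_i C i c *: X (row i W).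
  apply/matrixP => i j; rewrite [LHS]mxE [RHS]summxE; apply: eq_bigr => k _.
  by rewrite [RHS]mxE -DW; congr (_ * _); rewrite [RHS]mxE.
have trE (M : 'M[F]_n) (H : 'rV_N) :
    (forall i, H 0 i = \tr (M *m X (row i W))) ->
    (H *m C) 0 c = \tr (M *m map_mx DD (X y)).
  move=> HE; rewrite DDy mulmx_sumr linear_sum mxE; apply: eq_bigr => i _.
  by rewrite -scalemxAr linearZ /= HE mulrC.
have -> : (K *m gram *m W^T *m C) r c = (row r (K *m gram *m W^T) *m C) 0 c.
  by rewrite -row_mul [RHS]mxE.
rewrite (trE (X (row r K))) => [|i].
  apply: mxtrace_derivation => // k kn.
  rewrite -(trE (X y ^+ k) (row (Ordinal kn) (power_traces y *m W^T))) => [|i].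
    by rewrite -row_mul mulmx_coker linear0 mxE.
  by rewrite mxE power_tracesE.
rewrite gramE -!row_mul !mxE; apply: eq_bigr => j _; congr (_ * _).
by rewrite !mxE.
Qed.

Hypothesis lincomb_lie : forall c v, X (v *m adm c) = X c *m X v - X v *m X c.
Hypothesis gram_unit : gram \in unitmx.

Lemma gram_inj (u : 'rV[F]_d) : (forall v : 'rV_d, (u *m gram *m v^T) 0 0 = 0) -> u = 0.
Proof.
move=> u0; rewrite -[u](mulmxK gram_unit).
suff -> : u *m gram = 0 by rewrite mul0mx.
apply/rowP => j; have := u0 (delta_mx 0 j).
by rewrite trmx_delta -colE !mxE.
Qed.

Lemma kermx_adm_commute (u z : 'rV[F]_d) :
  u *m adm z = 0 -> X z *m X u = X u *m X z.
Proof.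
by move=> uz; apply/eqP; rewrite -subr_eq0 -lincomb_lie uz linear0.
Qed.

(** The gradient at [z] of the invariant polynomial [\tr (X z ^+ k.+1)], up to the
    factor [k.+1], centralises [z]. *)
Lemma power_traces_sub_kermx z :
  (power_traces z *m invmx gram <= kermx (adm z))%MS.
Proof.
apply/sub_kermxP/row_matrixP => k; rewrite row0.
rewrite row_mul; set u := row k _; apply: gram_inj => v.
rewrite -gramE lincomb_lie mulmxBl linearB /=.
have uE w : \tr (X u *m X w) = \tr (X z ^+ k *m X w).
  rewrite gramE /u row_mul mulmxKV //.
  have {2}-> : w = row 0 w by apply/rowP => j; rewrite mxE.
  by rewrite -power_tracesE -row_mul [LHS]mxE.
have -> : \tr (X z *m X u *m X v) = \tr (X u *m (X v *m X z)).
  by rewrite mulmxA [RHS]mxtrace_mulC mulmxA.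
rewrite -mulmxA -linearB -mulmxBr /= -opprB mulmxN linearN /= -lincomb_lie uE.
rewrite lincomb_lie mulmxBr linearB /= !mulmxA [X in _ - X]mxtrace_mulC.
by rewrite mulmxA !mulmxE -exprS -exprSr subrr oppr0.
Qed.

(** The gradients lie in the centraliser of [z], so on [W] they give no more functionals than it
    does. *)
Lemma rank_power_traces z N (W : 'M[F]_(N, d)) :
  (\rank (power_traces z *m W^T) <= \rank (kermx (adm z) *m gram *m W^T))%N.
Proof.
apply: mxrankS; rewrite -[power_traces z](mulmxKV gram_unit) -!mulmxA.
by rewrite !mulmxA -!(mulmxA _ gram); apply: submxMr; apply: power_traces_sub_kermx.
Qed.

(** What the centraliser of [z] loses when its elements are viewed, through the trace form, as
    functionals on the rows of [W]. *)
Definition nullity z N (W : 'M[F]_(N, d)) :=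
  \rank (kermx (adm z) :&: kermx (gram *m W^T)).

Lemma rank_kermx_nullity z N (W : 'M[F]_(N, d)) :
  (\rank (kermx (adm z) *m gram *m W^T) + nullity z W + \rank (adm z))%N = d.
Proof.
by rewrite -mulmxA mxrank_mul_ker mxrank_ker subnK // rank_leq_row.
Qed.

End MatrixLieAlgebra.

(** * Rank in polynomial families *)

Section Minors.
Variable F : fieldType.

Lemma row_free_rowsub m n p (A : 'M[F]_(m, n)) (f : 'I_p -> 'I_m) :
  injective f -> row_free A -> row_free (rowsub f A).
Proof.
move=> f_inj /row_freeP[B AB]; apply/row_freeP; exists (B *m (rowsub f 1%:M)^T).
rewrite rowsubE -mulmxA [A *m _]mulmxA AB mul1mx -rowsubE.
by apply/matrixP => i j; rewrite !mxE (inj_eq f_inj) eq_sym.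
Qed.

Lemma exists_row_free_rowsub m n (A : 'M[F]_(m, n)) k :
  (k <= \rank A)%N -> exists f : 'I_k -> 'I_m, row_free (rowsub f A).
Proof.
move=> kA; exists (maxrankfun A \o widen_ord kA); rewrite rowsub_comp.
by apply: row_free_rowsub (maxrowsub_free A) => i j [] /val_inj.
Qed.

Lemma rank_minorP m n (A : 'M[F]_(m, n)) k :
  reflect (exists (f : 'I_k -> 'I_m) (g : 'I_k -> 'I_n), \det (mxsub f g A) != 0)
          (k <= \rank A)%N.
Proof.
apply: (iffP idP) => [/exists_row_free_rowsub[f fA]|[f [g fgA]]].
  have kT : (k <= \rank (rowsub f A)^T)%N by rewrite mxrank_tr (eqP fA).
  have [g gA] := exists_row_free_rowsub kT.
  exists f, g; rewrite -unitfE -det_tr -unitmxE -row_free_unit.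
  rewrite (_ : (mxsub f g A)^T = rowsub g (rowsub f A)^T) //.
  by apply/matrixP => i j; rewrite !mxE.
have : row_free (mxsub f g A) by rewrite row_free_unit unitmxE unitfE.
rewrite /row_free => /eqP <-.
rewrite (_ : mxsub f g A = (rowsub g (rowsub f A)^T)^T); last first.
  by apply/matrixP => i j; rewrite !mxE.
rewrite mxrank_tr rowsubE; apply: leq_trans (mxrankM_maxr _ _) _.
by rewrite mxrank_tr rowsubE mxrankM_maxr.
Qed.
End Minors.

Section PolynomialFamilies.
Variable F : fieldType.

(** Polynomial dependence is a property of functions, so that sums, products and determinants need
    no matrices over [{poly F}]. *)
Definition polyfun (f : F -> F) : Prop := exists p : {poly F}, forall s, f s = p.[s].

Lemma polyfun_const c : polyfun (fun=> c).
Proof. by exists c%:P => s; rewrite hornerC. Qed.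

Lemma polyfun_id : polyfun id.
Proof. by exists 'X => s; rewrite hornerX. Qed.

Lemma polyfunD f g : polyfun f -> polyfun g -> polyfun (fun s => f s + g s).
Proof. by move=> [p fp] [q gq]; exists (p + q) => s; rewrite hornerD fp gq. Qed.

Lemma polyfunM f g : polyfun f -> polyfun g -> polyfun (fun s => f s * g s).
Proof. by move=> [p fp] [q gq]; exists (p * q) => s; rewrite hornerM fp gq. Qed.

Lemma polyfun_ext f g : f =1 g -> polyfun f -> polyfun g.
Proof. by move=> fg [p fp]; exists p => s; rewrite -fg. Qed.

Lemma polyfun_sum (I : Type) (r : seq I) (P : pred I) (f : I -> F -> F) :
  (forall i, polyfun (f i)) -> polyfun (fun s => \sum_(i <- r | P i) f i s).
Proof.
move=> fP; elim: r => [|i r IHr].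
  by apply: polyfun_ext (polyfun_const 0) => s; rewrite big_nil.
case Pi: (P i).
  by apply: polyfun_ext (polyfunD (fP i) IHr) => s; rewrite big_cons Pi.
by apply: polyfun_ext IHr => s; rewrite big_cons Pi.
Qed.

Lemma polyfun_prod (I : Type) (r : seq I) (f : I -> F -> F) :
  (forall i, polyfun (f i)) -> polyfun (fun s => \prod_(i <- r) f i s).
Proof.
move=> fP; elim: r => [|i r IHr].
  by apply: polyfun_ext (polyfun_const 1) => s; rewrite big_nil.
by apply: polyfun_ext (polyfunM (fP i) IHr) => s; rewrite big_cons.
Qed.

Definition mxpolyfun m n (A : F -> 'M[F]_(m, n)) : Prop :=
  forall i j, polyfun (fun s => A s i j).

Lemma mxpolyfun_const m n (A : 'M[F]_(m, n)) : mxpolyfun (fun=> A).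
Proof. by move=> i j; apply: polyfun_const. Qed.

Lemma mxpolyfunM m n p (A : F -> 'M[F]_(m, n)) (B : F -> 'M[F]_(n, p)) :
  mxpolyfun A -> mxpolyfun B -> mxpolyfun (fun s => A s *m B s).
Proof.
move=> pA pB i j.
apply: (@polyfun_ext (fun s => \sum_k A s i k * B s k j)) => [s|].
  by rewrite mxE.
by apply: polyfun_sum => k; apply: polyfunM.
Qed.

Lemma mxpolyfun_exp n (A : F -> 'M[F]_n) k :
  mxpolyfun A -> mxpolyfun (fun s => A s ^+ k).
Proof.
move=> pA; elim: k => [|k IHk] i j.
  by apply: (@polyfun_ext (fun=> (1%:M : 'M[F]_n) i j)) => //; apply: polyfun_const.
by apply: polyfun_ext (mxpolyfunM pA IHk i j) => s; rewrite exprS.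
Qed.

Lemma polyfun_det n (A : F -> 'M[F]_n) : mxpolyfun A -> polyfun (fun s => \det (A s)).
Proof.
move=> pA; apply: polyfun_sum => p; apply: polyfunM (polyfun_const _) _.
by apply: polyfun_prod => i; apply: pA.
Qed.

Lemma mxpolyfun_lincomb d m n (B : 'I_d -> 'M[F]_(m, n)) (c : F -> 'rV[F]_d) :
  mxpolyfun c -> mxpolyfun (fun s => lincomb B (c s)).
Proof.
move=> pc i j; apply: (@polyfun_ext (fun s => \sum_k c s 0 k * B k i j)) => [s|].
  by rewrite summxE; apply: eq_bigr => k _; rewrite mxE.
by apply: polyfun_sum => k; apply: polyfunM (pc _ _) (polyfun_const _).
Qed.

Lemma mxpolyfun_line d (u v : 'rV[F]_d) : mxpolyfun (fun s => u + s *: v).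
Proof.
move=> i j; apply: (@polyfun_ext (fun s => u i j + s * v i j)) => [s|].
  by rewrite !mxE.
by apply: polyfunD (polyfun_const _) (polyfunM polyfun_id (polyfun_const _)).
Qed.

Lemma mxpolyfun_power_traces n d (B : 'I_d -> 'M[F]_n) (z : F -> 'rV[F]_d) :
  mxpolyfun z -> mxpolyfun (fun s => power_traces B (z s)).
Proof.
move=> pz k j.
apply: (@polyfun_ext (fun s => \tr (lincomb B (z s) ^+ k *m B j))) => [s|].
  by rewrite mxE.
apply: polyfun_sum => l; apply: (mxpolyfunM _ (mxpolyfun_const _) l l).
exact/mxpolyfun_exp/mxpolyfun_lincomb.
Qed.

(** A minor that is nonzero at [s0] is a nonzero polynomial in [s], and the rank cannot be smaller
    where it does not vanish. *)
Lemma mxpolyfun_rank m n (A : F -> 'M[F]_(m, n)) s0 : mxpolyfun A ->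
  exists2 p : {poly F}, p != 0 &
    forall s, p.[s] != 0 -> (\rank (A s0) <= \rank (A s))%N.
Proof.
move=> pA; have /rank_minorP[f [g fgA]] := leqnn (\rank (A s0)).
have [p pE] : polyfun (fun s => \det (mxsub f g (A s))).
  by apply: polyfun_det => i j; apply: polyfun_ext (pA (f i) (g j)) => s; rewrite mxE.
exists p => [|s ps]; first by apply: contraNneq fgA => p0; rewrite pE p0 horner0.
by apply/rank_minorP; exists f, g; rewrite pE.
Qed.

Lemma exists_natr_nonroot (p : {poly F}) : (forall k, k.+1%:R != 0 :> F) ->
  p != 0 -> exists k : nat, p.[k%:R] != 0.
Proof.
move=> char0 p0; pose rs : seq F := [seq k%:R | k <- iota 0 (size p)].
have natr_inj : injective (fun k : nat => k%:R : F).
  have le_inj i j : (i <= j)%N -> i%:R = j%:R :> F -> i = j.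
    move=> ij /eqP; rewrite eq_sym -subr_eq0 -natrB //.
    by case: (j - i)%N (subnK ij) => [|m] <-; rewrite ?(negPf (char0 m)).
  by move=> i j ij; case: (leqP i j) => [/le_inj->|/ltnW/le_inj<-].
have : ~~ all (root p) rs.
  apply/negP => /(max_poly_roots p0); rewrite map_inj_uniq // iota_uniq.
  by rewrite size_map size_iota ltnn => /(_ isT).
by case/allPn => _ /mapP[k _ ->] pk; exists k.
Qed.
End PolynomialFamilies.

(** A full rank factorisation of a skew matrix takes the form [R^T *m G *m R] with [G] skew and
    invertible of size [r], the rank; comparing [\det G] with the determinant of its transpose
    excludes odd [r]. *)
Lemma skew_rank_even (F : fieldType) n (A : 'M[F]_n) :
  2%:R != 0 :> F -> A^T = - A -> ~~ odd (\rank A).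
Proof.
move=> char2 skA; have := mulmx_base A.
have /row_freeP[R' RR'] := row_base_free A.
have /row_fullP[C' C'C] := col_base_full A.
move: (\rank A) (col_base A) (row_base A) R' C' RR' C'C.
move=> r C R R' C' RR' C'C AE; pose G := - (C^T *m R').
have CG : C = R^T *m G.
  rewrite /G mulmxN mulmxA -trmx_mul AE skA mulNmx opprK.
  by rewrite -[LHS]mulmx1 -RR' mulmxA AE.
have R'R : R'^T *m R^T = 1%:M by rewrite -trmx_mul RR' trmx1.
have GE : G = R'^T *m A *m R'.
  by rewrite -AE CG !mulmxA R'R mul1mx -mulmxA RR' mulmx1.
have GT : G^T = - G by rewrite GE !trmx_mul trmxK skA mulNmx mulmxN mulmxA.
have /mulmx1_unit[_ Gu] : (C' *m R^T) *m G = 1%:M by rewrite -mulmxA -CG.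
have : \det G = (-1) ^+ r * \det G by rewrite -{1}det_tr GT -scaleN1r detZ.
rewrite -signr_odd; case: odd => // /eqP; rewrite expr1 mulN1r -addr_eq0.
rewrite unitmxE unitfE in Gu.
by rewrite -mulr2n -mulr_natl mulf_eq0 (negPf char2) (negPf Gu).
Qed.

(** * Pencils over a differential field *)

Section Pencil.
Variables (F : fieldType) (n d : nat).
Variables (B : 'I_d -> 'M[F]_n) (S : 'I_d -> 'M[F]_d).
Local Notation X := (lincomb B).
Local Notation adm := (lincomb S).
Local Notation G := (gram B).
Hypothesis char0 : forall k, k.+1%:R != 0 :> F.
Hypothesis lincomb_lie : forall c v, X (v *m adm c) = X c *m X v - X v *m X c.
Hypothesis gram_unit : G \in unitmx.

Variable s : 'M[F]_d.
Hypothesis s_inv : s *m s = 1%:M.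
Hypothesis s_lie : forall c v : 'rV_d, (v *m s) *m adm (c *m s) = v *m adm c *m s.
Hypothesis s_isom : s *m G *m s^T = G.

Variables (N : nat) (Mt : 'M[F]_(N, d)) (a : 'rV[F]_d).
Hypothesis Mt_s : Mt *m s = Mt.
Hypothesis a_s : a *m s = - a.
(** In the application, a fixed vector of the involution that is orthogonal to m~ is orthogonal to
    all of m, and so lies in the centraliser of [a]. *)
Hypothesis orth_Mt_commute : forall u : 'rV_d,
  u *m s = u -> u *m G *m Mt^T = 0 -> u *m adm a = 0.

Let eqN0 p q (A : 'M[F]_(p, q)) : A = - A -> A = 0.
Proof.
move=> AN; apply/eqP; have /eqP := AN; rewrite -addr_eq0 -mulr2n -scaler_nat.
by rewrite scaler_eq0 (negPf (char0 1)).
Qed.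

Let orth_eigen p (u : 'rV[F]_d) (A : 'M[F]_(p, d)) e e' :
  (e = 1 /\ e' = -1) \/ (e = -1 /\ e' = 1) ->
  u *m s = e *: u -> A *m s = e' *: A -> u *m G *m A^T = 0.
Proof.
move=> ee us As; apply: eqN0; rewrite -[in LHS]s_isom !mulmxA us -mulmxA -trmx_mul As.
rewrite linearZ /= -!scalemxAl -!scalemxAr scalerA.
have -> : e * e' = -1 by case: ee => -[-> ->]; rewrite ?mulN1r ?mulrN1 ?mul1r.
by rewrite scaleN1r.
Qed.

Section Twist.
Variables (x : 'rV[F]_d) (x_s : x *m s = x).
Let M := col_mx Mt a.

Lemma orth_M (u : 'rV_d) :
  (u *m (G *m M^T) == 0) = (u *m G *m Mt^T == 0) && (u *m G *m a^T == 0).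
Proof. by rewrite tr_col_mx mul_mx_row mul_mx_row !mulmxA row_mx_eq0. Qed.

(** An element [up + um] of the centraliser of [x + l a] orthogonal to [M], split
    along the eigenspaces of [s], lies in a pencil: [up *+ m + um *+ l] centralises
    [x + m a] for all [m]. *)
Lemma centralizer_twist (u : 'rV_d) l m : l != 0 ->
    u *m adm (x + l *: a) = 0 -> u *m (G *m M^T) = 0 ->
  let u' := (m / l) *: (u + u *m s) + (u - u *m s) in
  u' *m adm (x + m *: a) = 0 /\ u' *m (G *m M^T) = 0.
Proof.
move=> l0 uy /eqP; rewrite orth_M => /andP[/eqP uMt /eqP ua] u'.
set up := u + u *m s in u' *; set um := u - u *m s in u' *.
have ups : up *m s = up by rewrite mulmxDl -mulmxA s_inv mulmx1 addrC.
have ums : um *m s = - um by rewrite mulmxBl -mulmxA s_inv mulmx1 opprB.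
have usMt : u *m s *m G *m Mt^T = u *m G *m Mt^T.
  by rewrite -{2}s_isom !mulmxA -(mulmxA _ s^T) -trmx_mul Mt_s.
have usa : u *m s *m G *m a^T = - (u *m G *m a^T).
  by rewrite -{2}s_isom !mulmxA -(mulmxA _ s^T) -trmx_mul a_s linearN /= mulmxN opprK.
have upMt : up *m G *m Mt^T = 0 by rewrite !mulmxDl usMt uMt addr0.
have umMt : um *m G *m Mt^T = 0 by rewrite !mulmxBl usMt uMt subr0.
have upa : up *m G *m a^T = 0 by rewrite !mulmxDl usa ua subrr.
have uma : um *m G *m a^T = 0 by rewrite !mulmxBl usa ua oppr0 subrr.
have upA := orth_Mt_commute ups upMt.
have u'D p (v w : 'rV_d) (A : 'M_(d, p)) :
    ((m / l) *: v + w) *m A = (m / l) *: (v *m A) + w *m A.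
  by rewrite mulmxDl -scalemxAl.
split; last first.
  apply/eqP; rewrite orth_M /u' !u'D.
  by rewrite upMt umMt upa uma !scaler0 !addr0 !eqxx.
(* Applying [s] shows that [u *m s] centralises [x - l *: a]. The difference and the sum of the two
   relations give the equations for [um] and [up]. *)
have us_adm : (u *m s) *m adm (x - l *: a) = 0.
  have -> : x - l *: a = (x + l *: a) *m s by rewrite mulmxDl x_s -scalemxAl a_s scalerN.
  by rewrite s_lie uy mul0mx.
have admD (v : 'rV_d) k : v *m adm (x + k *: a) = v *m adm x + k *: (v *m adm a).
  by rewrite linearD linearZ /= mulmxDr scalemxAr.
move: uy us_adm; rewrite -scaleNr !admD => uy us_adm.
have umx : um *m adm x = 0.
  have : um *m adm x + l *: (up *m adm a) = 0.
    rewrite mulmxBl mulmxDl scalerDr addrACA -[X in _ + (- _ + X)]opprK -scaleNr -opprD.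
    by rewrite uy us_adm subrr.
  by rewrite upA scaler0 addr0.
have upx : up *m adm x + l *: (um *m adm a) = 0.
  rewrite mulmxDl mulmxBl scalerBr addrACA -scaleNr.
  by rewrite uy us_adm addr0.
rewrite /u' !u'D upA umx scaler0 addr0 add0r.
have -> : m *: (um *m adm a) = (m / l) *: (l *: (um *m adm a)) by rewrite scalerA divfK.
by rewrite -scalerDr upx scaler0.
Qed.

(** The map of [centralizer_twist] is linear in [u] and invertible: its inverse is a quarter of the
    same map with [l] and [m] exchanged. *)
Lemma nullity_twist l m : l != 0 -> m != 0 ->
  (nullity B S (x + l *: a) M <= nullity B S (x + m *: a) M)%N.
Proof.
move=> l0 m0; pose T e := e *: (1%:M + s) + (1%:M - s) : 'M[F]_d.
have TT : T (m / l) *m T (l / m) = 4%:R%:M.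
  have expand (P Q : 'M[F]_d) e e' : P *m Q = 0 -> Q *m P = 0 ->
      (e *: P + Q) *m (e' *: P + Q) = (e * e') *: (P *m P) + Q *m Q.
    move=> PQ QP; rewrite mulmxDl !mulmxDr -!scalemxAl -!scalemxAr PQ QP.
    by rewrite !scaler0 addr0 add0r scalerA.
  rewrite /T expand.
  - have -> : (1%:M + s) *m (1%:M + s) = (1%:M + s) *+ 2.
      by rewrite mulmxDl !mulmxDr !mul1mx !mulmx1 s_inv [s + _]addrC mulr2n.
    have -> : (1%:M - s) *m (1%:M - s) = (1%:M - s) *+ 2.
      rewrite mulmxBl !mulmxBr !mul1mx !mulmx1 s_inv mulr2n; congr (_ + _).
      by rewrite opprB.
    rewrite mulrA divfK // divff // scale1r.
    by rewrite -mulrnDl addrACA subrr addr0 -mulr2n -mulrnA -scaler_nat scalemx1.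
  - by rewrite mulmxDl !mulmxBr !mul1mx !mulmx1 s_inv addrA subrK subrr.
  - by rewrite mulmxBl !mulmxDr !mul1mx !mulmx1 s_inv [s + _]addrC subrr.
have Tfree : row_free (T (m / l)).
  apply/row_freeP; exists (4%:R^-1 *: T (l / m)).
  by rewrite -scalemxAr TT scale_scalar_mx mulVf // char0.
rewrite /nullity -(mxrankMfree _ Tfree); apply: mxrankS.
set K := (_ :&: _)%MS; apply/row_subP => i; rewrite row_mul.
have Ky : row i K *m adm (x + l *: a) = 0.
  by apply/sub_kermxP/(submx_trans (row_sub _ _))/capmxSl.
have KM : row i K *m (G *m M^T) = 0.
  by apply/sub_kermxP/(submx_trans (row_sub _ _))/capmxSr.
have [y0 M0] := @centralizer_twist (row i K) l m l0 Ky KM.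
have -> : row i K *m T (m / l) =
   (m / l) *: (row i K + row i K *m s) + (row i K - row i K *m s).
  by rewrite mulmxDr -scalemxAr mulmxDr mulmxDr mulmxN !mulmx1.
by rewrite sub_capmx; apply/andP; split; apply/sub_kermxP.
Qed.

(** Otherwise the centraliser of [y = x + l *: a] has dimension at least that of [x]
    plus two.  Modulo [nullity], which does not depend on [l], all but one dimension
    of it is accounted for by the gradients of the [\tr (X y ^+ k)]; at a generic
    point of the pencil these leave room only for the dimension of the centraliser
    of [x]. *)
Lemma pencil_regular l (D : 'I_N -> F -> F) (lam : 'I_N -> F) :
    l != 0 -> (forall i, derivation (D i)) ->
    (forall i, map_mx (D i) (X (x + l *: a)) = X (row i Mt + lam i *: a)) ->
  (\rank (adm x) <= (\rank (adm (x + l *: a))).+1)%N.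
Proof.
move=> l0 derD Dy; rewrite leqNgt; apply/negP => rk.
set y := x + l *: a in Dy rk.
(* The rows of [W] are the images of [y] under the [D i]. *)
pose W : 'M_(N, d) := Mt + (\col_i lam i) *m a.
have rowW i : row i W = row i Mt + lam i *: a.
  by rewrite linearD /= row_mul; congr (_ + _); apply/rowP => j; rewrite !mxE
    big_ord_recl big_ord0 addr0 !mxE.
have pz : mxpolyfun (fun m => x + m *: a) by apply: mxpolyfun_line.
have [p1 p10 p1P] := mxpolyfun_rank l
  (mxpolyfunM (mxpolyfun_power_traces B pz) (mxpolyfun_const M^T)).
have [p2 p20 p2P] := mxpolyfun_rank 0 (mxpolyfun_lincomb S pz).
(* At the generic point [z] of the pencil the gradients give at least as many functionals on [M] as
   at [y], and [adm] has at least the rank it has at [x]. The factor ['X] keeps the parameter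
   nonzero, as [nullity_twist] requires. *)
have [|k] := @exists_natr_nonroot _ (p1 * p2 * 'X) char0.
  by rewrite !mulf_neq0 // polyX_eq0.
rewrite !hornerM hornerX !mulf_eq0 !negb_or => /andP[/andP[/p1P rT /p2P rz] k0].
move: rT rz; set z := x + k%:R *: a => rT rz; rewrite scale0r addr0 in rz.
have nz : nullity B S z M = nullity B S y M.
  by apply/eqP; rewrite eqn_leq !nullity_twist.
have dz := rank_kermx_nullity B S z M; have dy := rank_kermx_nullity B S y M.
have Tz := rank_power_traces lincomb_lie gram_unit z M.
set A := kermx (adm y) in dy *.
have AW : (\rank (A *m G *m W^T) <= \rank (power_traces B y *m W^T))%N.
  apply: mxrankS; apply: commuting_sub_power_traces char0 derD _ _ => i.
    by rewrite Dy rowW.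
  apply: kermx_adm_commute => //; apply/sub_kermxP; exact: row_sub.
have TW : (\rank (power_traces B y *m W^T) <= \rank (power_traces B y *m M^T))%N.
  have -> : W = row_mx 1%:M (\col_i lam i) *m M by rewrite mul_row_col mul1mx.
  by rewrite trmx_mul mulmxA mxrankM_maxl.
(* [M] is recovered from [W] by adding the single row [a], which accounts for at most one
   dimension. *)
have AM : (\rank (A *m G *m M^T) <= \rank (A *m G *m W^T) + 1)%N.
  have -> : M = block_mx 1%:M (- (\col_i lam i)) 0 1%:M *m col_mx W a.
    rewrite mul_block_col !mul1mx mul0mx add0r mulNmx.
    by rewrite addrK.
  rewrite trmx_mul mulmxA; apply: leq_trans (mxrankM_maxl _ _) _.
  rewrite tr_col_mx mul_mx_row -mxrank_tr tr_row_mx -addsmxE.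
  apply: leq_trans (mxrank_adds_leqif _ _) _; rewrite !mxrank_tr leq_add2l.
  exact: rank_leq_col.
have rA := leq_trans AM (leq_add (leq_trans AW (leq_trans TW (leq_trans rT Tz))) (leqnn 1)).
have arith (ra rb nu ry rw rx : nat) : (ra <= rb + 1)%N -> (rb + nu + rw = d)%N ->
  (ra + nu + ry = d)%N -> (rx <= rw)%N -> (ry.+1 < rx)%N -> False by lia.
by rewrite nz in dz; apply: arith rA dz dy rz rk.
Qed.
End Twist.
End Pencil.

(** * Gradients at one point bound the rank of [adm] everywhere *)

Section GenericRank.
Variables (F : fieldType) (n d : nat).
Variables (B : 'I_d -> 'M[F]_n) (S : 'I_d -> 'M[F]_d).
Local Notation X := (lincomb B).
Local Notation adm := (lincomb S).
Local Notation G := (gram B).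
Hypothesis char0 : forall k, k.+1%:R != 0 :> F.
Hypothesis lincomb_lie : forall c v, X (v *m adm c) = X c *m X v - X v *m X c.
Hypothesis gram_unit : G \in unitmx.

(** The gradients of the [\tr (X z ^+ k)] supply [d - \rank (adm x) - c]
    independent functionals on [W] at [z = x], hence at most points [z] of any line
    through [x]; they and the centre [Z] lie in the centraliser of [z]. *)
Lemma rank_adm_le_generic N (W : 'M[F]_(N, d)) (x : 'rV[F]_d)
    (D : 'I_N -> F -> F) c (Z : 'M[F]_(c, d)) (z0 : 'rV[F]_d) :
    (forall i, derivation (D i)) -> (forall i, map_mx (D i) (X x) = X (row i W)) ->
    row_free Z -> (forall z, Z *m adm z = 0) -> Z *m G *m W^T = 0 ->
    (nullity B S x W <= c)%N ->
  (\rank (adm z0) <= \rank (adm x))%N.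
Proof.
move=> derD Dx Zfree Zadm ZW nullx.
have pz : mxpolyfun (fun s => z0 + s *: (x - z0)) by apply: mxpolyfun_line.
have [p1 p10 p1P] := mxpolyfun_rank 1
  (mxpolyfunM (mxpolyfun_power_traces B pz) (mxpolyfun_const W^T)).
have [p2 p20 p2P] := mxpolyfun_rank 0 (mxpolyfun_lincomb S pz).
have [|k] := @exists_natr_nonroot _ (p1 * p2) char0; first by rewrite mulf_neq0.
rewrite hornerM mulf_eq0 negb_or => /andP[/p1P rT /p2P rz].
rewrite scale1r addrC subrK in rT; rewrite scale0r addr0 in rz.
move: rT rz; set z := z0 + _ => rT rz.
have Tz := rank_power_traces lincomb_lie gram_unit z W.
have Tx : (\rank (kermx (adm x) *m G *m W^T) <= \rank (power_traces B x *m W^T))%N.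
  apply: mxrankS; apply: commuting_sub_power_traces char0 derD Dx _ => i.
  by apply: kermx_adm_commute => //; apply/sub_kermxP/row_sub.
(* The rows of [Z] centralise every point and are orthogonal to [W], which bounds the nullity from
   below. *)
have nullz : (c <= nullity B S z W)%N.
  rewrite -{1}(eqP Zfree); apply: mxrankS; rewrite sub_capmx.
  by apply/andP; split; apply/sub_kermxP; rewrite ?mulmxA.
have dx := rank_kermx_nullity B S x W; have dz := rank_kermx_nullity B S z W.
have arith (ra rb nu nu' rx rw r0 : nat) : (ra <= rb)%N -> (ra + nu + rx = d)%N ->
  (rb + nu' + rw = d)%N -> (r0 <= rw)%N -> (nu <= c)%N -> (c <= nu')%N -> (r0 <= rx)%N.
  lia.
exact: (arith _ _ _ _ _ _ _ (leq_trans Tx (leq_trans rT Tz)) dx dz rz nullx nullz).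
Qed.
End GenericRank.

(** * Rational functions *)

(** A nonzero combination of least degree is chosen; the remainder of [q i] by it is a combination
    of smaller degree, hence zero. *)
Lemma bezout_family (K : fieldType) (I : finType) (q : I -> {poly K}) i0 :
    q i0 != 0 ->
  exists g, [/\ g != 0, forall i, g %| q i & exists a, g = \sum_i a i * q i].
Proof.
move=> q0; pose ideal g := exists a, g = \sum_i a i * q i.
have idq i : ideal (q i).
  exists (fun j => (j == i)%:R); rewrite (bigD1 i) //= eqxx mul1r big1 ?addr0 //.
  by move=> j /negPf ->; rewrite mul0r.
have idD g h : ideal g -> ideal h -> ideal (g + h).
  move=> [a ->] [b ->]; exists (fun i => a i + b i); rewrite -big_split /=.
  by apply: eq_bigr => i _; rewrite mulrDl.
have idM g h : ideal h -> ideal (g * h).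
  move=> [b ->]; exists (fun i => g * b i); rewrite mulr_sumr.
  by apply: eq_bigr => i _; rewrite mulrA.
have exm : exists m, `[< exists g, [/\ g != 0, ideal g & size g = m] >].
  by exists (size (q i0)); apply/asboolP; exists (q i0).
case: (ex_minnP exm) => m /asboolP[g [g0 idg gm]] min_m.
exists g; split=> // i; apply/modp_eq0P/eqP; apply: contraT => r0.
have : (m <= size (q i %% g)%R)%N.
  apply: min_m; apply/asboolP; exists (q i %% g); split=> //.
  have -> : q i %% g = q i + (- (q i %/ g)) * g.
    by rewrite {2}(divp_eq (q i) g) mulNr addrAC subrr add0r.
  by apply: idD (idq i) (idM _ _ idg).
by rewrite leqNgt -gm ltn_modp g0.
Qed.

Section Fractions.
Variable A : idomainType.
Local Notation frac := (@FracField.tofrac A).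

Lemma fraction_numden (f : {fraction A}) :
  exists u v, v != 0 /\ f = frac u / frac v.
Proof.
elim/quotW: f => r; exists \n_r, \d_r.
have r0 := denom_ratioP r; split=> //.
apply: (canRL (mulfK _)); first by rewrite tofrac_eq0.
unlock FracField.tofrac; rewrite -[LHS]FracField.pi_mul /FracField.mulf.
apply/eqmodP; rewrite /= FracField.equivfE !numden_Ratio ?mulf_neq0 ?oner_eq0 //.
by rewrite !mulr1 mulrC.
Qed.

Lemma common_denominator (J : finType) (f : J -> {fraction A}) :
  exists2 e, e != 0 & exists u : J -> A, forall j, frac e * f j = frac (u j).
Proof.
have /choice[u /choice[v uv]] := fun j => fraction_numden (f j).
exists (\prod_j v j); first by apply/prodf_neq0 => j _; case: (uv j).
exists (fun j => u j * \prod_(k | k != j) v k) => j.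
have [v0 ->] := uv j; rewrite (bigD1 j) //= !tofracM.
by rewrite mulrC mulrA divfK ?tofrac_eq0.
Qed.

(** The quotient rule; [dE] is its independence of the chosen numerator and denominator. *)
Lemma derivation_fraction (D : A -> A) : derivation D ->
  exists2 D' : {fraction A} -> {fraction A}, derivation D' &
    forall x, D' (frac x) = frac (D x).
Proof.
move=> derD; pose d (u v : A) := frac (D u * v - u * D v) / frac (v * v).
have dE u v u' v' : v != 0 -> v' != 0 -> frac u / frac v = frac u' / frac v' ->
    d u v = d u' v'.
  move=> v0 v'0 /eqP; rewrite eqr_div ?tofrac_eq0 // -!tofracM tofrac_eq => /eqP uv.
  have Duv : D u * v' + u * D v' = D u' * v + u' * D v by rewrite -!derD.2 uv.
  apply/eqP; rewrite eqr_div ?tofrac_eq0 ?mulf_neq0 // -!tofracM tofrac_eq.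
  have -> : (D u * v - u * D v) * (v' * v')
      = v * v' * (D u * v' + u * D v') - u * v' * (v' * D v + v * D v') by ring.
  by rewrite Duv uv; apply/eqP; ring.
have /choice[n /choice[m nm]] := fraction_numden.
exists (fun f => d (n f) (m f)); last first.
  move=> x; have [m0 xE] := nm (frac x).
  rewrite (@dE _ _ x 1) ?oner_eq0 //; last by rewrite -xE tofrac1 divr1.
  by rewrite /d (derivation1 derD) !mulr1 mulr0 subr0 tofrac1 divr1.
split=> f g; have [f0 fE] := nm f; have [g0 gE] := nm g.
  have [fg0 fgE] := nm (f + g).
  rewrite (@dE _ _ (n f * m g + n g * m f) (m f * m g)) ?mulf_neq0 //; last first.
    rewrite -fgE {1}fE {1}gE tofracD !tofracM.
    by rewrite addf_div ?tofrac_eq0.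
  rewrite /d addf_div ?tofrac_eq0 ?mulf_neq0 // -!tofracM -tofracD.
  apply/eqP; rewrite eqr_div ?tofrac_eq0 ?mulf_neq0 // -!tofracM tofrac_eq.
  by rewrite derD.1 !derD.2; apply/eqP; ring.
have [fg0 fgE] := nm (f * g).
rewrite (@dE _ _ (n f * n g) (m f * m g)) ?mulf_neq0 //; last first.
  by rewrite -fgE {1}fE {1}gE !tofracM mulf_div.
have dM u v u' v' : v != 0 -> v' != 0 ->
    d (u * u') (v * v') = d u v * (frac u' / frac v') + frac u / frac v * d u' v'.
  move=> v0 v'0; rewrite /d !mulf_div addf_div ?mulf_neq0 ?tofrac_eq0 ?mulf_neq0 //.
  rewrite -!tofracM -tofracD.
  apply/eqP; rewrite eqr_div ?tofrac_eq0 ?mulf_neq0 // -!tofracM tofrac_eq.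
  by rewrite !derD.2; apply/eqP; ring.
by rewrite dM // -gE -fE.
Qed.

Lemma rank_map_fraction m n (P : 'M[A]_(m, n)) k :
  (k <= \rank (map_mx frac P))%N <->
  exists (f : 'I_k -> 'I_m) (g : 'I_k -> 'I_n), \det (mxsub f g P) != 0.
Proof.
split=> [/rank_minorP|] [f [g fg]]; last apply/rank_minorP; exists f, g; move: fg.
  by rewrite -map_mxsub det_map_mx tofrac_eq0.
by rewrite -map_mxsub det_map_mx tofrac_eq0.
Qed.

(** A minor that vanishes identically vanishes under every specialisation, so the rank is largest
    over the fraction field. *)
Lemma rank_map_le_fraction (F : fieldType) (h : {rmorphism A -> F}) m n
    (P : 'M[A]_(m, n)) :
  (\rank (map_mx h P) <= \rank (map_mx frac P))%N.
Proof.
apply/rank_map_fraction.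
have /rank_minorP[f [g fg]] := leqnn (\rank (map_mx h P)).
exists f, g; apply: contraNneq fg => P0.
by rewrite -map_mxsub det_map_mx P0 rmorph0.
Qed.

(** Elimination of the variable: either the [q i] have a common factor over the fraction field, or a
    Bezout identity with cleared denominators excludes common roots after any specialisation at
    which [e] does not vanish. *)
Lemma bezout_family_fraction (I : finType) (q : I -> {poly A}) :
    (exists i, q i != 0) ->
  (exists2 g : {poly {fraction A}}, (1 < size g)%N &
     forall i, g %| map_poly frac (q i)) \/
  exists2 e : A, e != 0 & exists a : I -> {poly A}, \sum_i a i * q i = e%:P.
Proof.
move=> [i0 q0]; pose Q i : {poly {fraction A}} := map_poly frac (q i).
have frac_inj : injective (map_poly frac : {poly A} -> {poly {fraction A}}).
  by apply: map_inj_poly; [move=> x y /eqP; rewrite tofrac_eq => /eqP | exact: tofrac0].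
have [|g [g0 gQ [a gE]]] := @bezout_family _ _ Q i0.
  by apply: contra_neq q0; rewrite -(rmorph0 (map_poly frac)) => /frac_inj.
have [g1|g1] := leqP (size g) 1; last by left; exists g.
right; have [c c0 gc] : exists2 c, c != 0 & g = c%:P.
  by exists g`_0; [rewrite -polyC_eq0 -size1_polyC | exact: size1_polyC].
pose m := \max_i size (a i).
have [e e0 [u uE]] := common_denominator (fun j : I * 'I_m => (a j.1)`_j.2 / c).
exists e => //; exists (fun i => \poly_(k < m) (if insub k is Some k' then u (i, k') else 0)).
apply: frac_inj; rewrite map_polyC rmorph_sum /=.
have aE i : map_poly frac (\poly_(k < m) (if insub k is Some k' then u (i, k') else 0))
    = (frac e / c)%:P * a i.
  apply/polyP => k; rewrite coef_map coef_poly coefCM; case: ltnP => km.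
    by rewrite insubT /= -uE /= -mulrA [c^-1 * _]mulrC.
  rewrite raddf0 [(a i)`_k]nth_default ?mulr0 // (leq_trans _ km) //.
  exact: (leq_bigmax_cond i).
under eq_bigr => i _ do rewrite rmorphM /= aE -mulrA.
by rewrite -mulr_sumr -gE gc -polyCM divfK.
Qed.
End Fractions.

Lemma horner_muni (C : comNzRingType) n (p : {mpoly C[n.+1]}) (v : 'I_n.+1 -> C) :
  (map_poly (meval (fun i => v (widen_ord (leqnSn n) i))) (muni p)).[v ord_max]
  = p.@[v].
Proof.
rewrite muniE mevalE rmorph_sum horner_sum; apply: eq_bigr => m _ /=.
rewrite map_polyZ map_polyXn hornerZ hornerXn /= mevalZ mevalX -mulrA.
rewrite [in RHS]big_ord_recr /=; congr (_ * (_ * _)).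
by apply: eq_bigr => i _; rewrite mnmE.
Qed.

Lemma muni_eq0 (C : comNzRingType) n (p : {mpoly C[n.+1]}) : muni p = 0 -> p = 0.
Proof.
move=> p0; apply/mpolyP => m; rewrite mcoeff0; apply/eqP.
rewrite -[_ == 0]negbK -mcoeff_msupp; apply/negP => pm.
pose r (m : 'X_{1..n.+1}) := [multinom m (widen_ord (leqnSn n) i) | i < n].
have rK m' : r m' = r m -> m' ord_max = m ord_max -> m' = m.
  move=> rm mm; apply/mnmP => i; have [ilt|] := ltnP i n; last first.
    rewrite leq_eqVlt ltnNge -ltnS ltn_ord orbF => /eqP ni.
    by rewrite (_ : i = ord_max) //; apply/val_inj.
  move/mnmP/(_ (Ordinal ilt)): rm; rewrite !mnmE.
  by rewrite (_ : widen_ord _ _ = i) //; apply/val_inj.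
have : ((muni p)`_(m ord_max))@_(r m) = 0 by rewrite p0 coef0 mcoeff0.
rewrite muniE coef_sum raddf_sum (bigD1_seq m) ?msupp_uniq //=.
rewrite coefZ coefXn eqxx mulr1 mcoeffZ mcoeffX eqxx mulr1 big1 ?addr0.
  by move/eqP; rewrite -[_ == 0]negbK -mcoeff_msupp pm.
move=> m' m'm; rewrite coefZ coefXn; case: eqP => [mm|_]; last by rewrite mulr0 mcoeff0.
rewrite mulr1 mcoeffZ mcoeffX; case: eqP => [/rK m'E|_]; last by rewrite mulr0.
by rewrite m'E // eqxx in m'm.
Qed.

(** Induction on the number of variables: the leading coefficient in the last variable is made
    nonzero first, then the last variable is chosen. Natural coordinates keep the point real in the
    application. *)
Lemma mpoly_nonroot (C : fieldType) n (p : {mpoly C[n]}) :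
    (forall k, k.+1%:R != 0 :> C) -> p != 0 ->
  exists v : 'I_n -> nat, p.@[fun i => (v i)%:R] != 0.
Proof.
move=> char0; elim: n p => [|n IHn] p p0.
  exists (fun=> 0%N); apply: contra_neq p0 => pv.
  have pE : p = (p@_0)%:MP.
    apply/mpolyP => m; rewrite mcoeffC; have -> : m = 0%MM by apply/mnmP => - [].
    by rewrite eqxx mulr1.
  by rewrite pE mevalC in pv; rewrite pE pv.
have up0 : muni p != 0 by apply: contra_neq p0; apply: muni_eq0.
have [|v pv] := IHn (lead_coef (muni p)); first by rewrite lead_coef_eq0.
have [|k pk] := @exists_natr_nonroot C
    (map_poly (meval (fun i => (v i)%:R)) (muni p)) char0.
  by apply: contra_neq pv => /(congr1 (coefp (size (muni p)).-1)) /=; rewrite coef0 coef_map.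
pose w (i : 'I_n.+1) := if insub (i : nat) is Some j then v j else k.
have wE : (fun i => (w (widen_ord (leqnSn n) i))%:R) = (fun i => (v i)%:R) :> ('I_n -> C).
  apply: funext => i; rewrite /w; case: insubP => [j _ ji|/=]; last by rewrite ltn_ord.
  by congr (_%:R); congr v; apply/val_inj.
by exists w; rewrite -horner_muni wE /w insubF ?ltnn.
Qed.

Section FunctionField.
Variables (C : fieldType) (N : nat).
Local Notation A := {mpoly C[N]}.
Local Notation K := {fraction {mpoly C[N]}}.

Lemma function_field_derivations :
  exists D : 'I_N -> K -> K, [/\ forall j, derivation (D j),
    forall j c, D j (FracField.tofrac c%:MP) = 0
  & forall i j, D j (FracField.tofrac 'X_i) = (i == j)%:R].
Proof.
have /choice[D DE] : forall j : 'I_N, exists D : K -> K, derivation D /\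
    forall p, D (FracField.tofrac p) = FracField.tofrac (p^`M(j)).
  move=> j; have [|D derD DE] := @derivation_fraction A (fun p => p^`M(j)).
    by split=> p q; rewrite ?mderivD // mderivM.
  by exists D.
exists D; split=> [j|j c|i j]; first by case: (DE j).
  by rewrite (DE j).2 mderivC tofrac0.
rewrite (DE j).2 mderivX mnm1E; case: eqP => [->|_]; last by rewrite scale0r tofrac0.
rewrite scale1r (_ : (_ - _)%MM = 0%MM); last by apply/mnmP => l; rewrite mnmBE subnn mnm0E.
by rewrite mpolyX0 tofrac1.
Qed.
End FunctionField.

(** * Generic points *)

Lemma map_lincomb (R R' : comNzRingType) (f : {rmorphism R -> R'}) d m n
    (B : 'I_d -> 'M[R]_(m, n)) (c : 'rV[R]_d) :
  map_mx f (lincomb B c) = lincomb (fun i => map_mx f (B i)) (map_mx f c).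
Proof.
rewrite /lincomb raddf_sum /=; apply: eq_bigr => i _.
by rewrite map_mxZ mxE.
Qed.

Lemma lincomb_delta (R : comNzRingType) d m n (B : 'I_d -> 'M[R]_(m, n)) i :
  lincomb B (delta_mx 0 i) = B i.
Proof.
rewrite /lincomb (bigD1 i) //= big1 => [|j ji].
  by rewrite mxE !eqxx scale1r addr0.
by rewrite mxE (negPf ji) andbF scale0r.
Qed.

Lemma map_lincomb_derivation (R : comNzRingType) (D : R -> R) d m n
    (B : 'I_d -> 'M[R]_(m, n)) (c : 'rV[R]_d) :
  derivation D -> (forall i j k, D (B i j k) = 0) ->
  map_mx D (lincomb B c) = lincomb B (map_mx D c).
Proof.
move=> derD DB; apply/matrixP => j k; rewrite mxE !summxE derivation_sum //.
by apply: eq_bigr => i _; rewrite !mxE derD.2 DB mulr0 addr0.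
Qed.

Section LieBasis.
Variables (F : fieldType) (n d : nat).
Variables (B : 'I_d -> 'M[F]_n) (S : 'I_d -> 'M[F]_d).

(** Stated on basis vectors only, so that it passes to larger fields; [lincomb_lie_basis] recovers
    it for all vectors. *)
Definition lie_basis : Prop :=
  forall i j, lincomb B (row j (S i)) = B i *m B j - B j *m B i.

Lemma lincomb_lie_basis : lie_basis -> forall c v : 'rV_d,
  lincomb B (v *m lincomb S c) =
  lincomb B c *m lincomb B v - lincomb B v *m lincomb B c.
Proof.
move=> lieB c v.
rewrite {1}/(lincomb S c) mulmx_sumr linear_sum /(lincomb B c).
rewrite mulmx_suml mulmx_sumr -sumrB; apply: eq_bigr => i _ /=.
rewrite -scalemxAr linearZ /= -scalemxAl -scalemxAr -scalerBr; congr (_ *: _).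
rewrite mulmx_sum_row linear_sum /lincomb mulmx_sumr mulmx_suml -sumrB.
apply: eq_bigr => j _ /=; rewrite -scalemxAr -scalemxAl -scalerBr -lieB.
exact: linearZ.
Qed.
End LieBasis.

(** This turns [nullity] into the corank of a single matrix, to which semicontinuity of the rank
    applies. *)
Lemma rank_cap_ker (F : fieldType) m n p (A : 'M[F]_(m, n)) (B : 'M[F]_(m, p)) :
  (\rank (kermx A :&: kermx B) + \rank (row_mx A B))%N = m.
Proof.
have -> : \rank (kermx A :&: kermx B) = \rank (kermx (row_mx A B)).
  apply/eqP; rewrite eqn_leq; apply/andP; split; apply: mxrankS.
    apply/sub_kermxP; rewrite mul_mx_row; apply/eqP; rewrite row_mx_eq0.
    by apply/andP; split; apply/eqP/sub_kermxP; rewrite ?capmxSl ?capmxSr.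
  have /eqP := mulmx_ker (row_mx A B); rewrite mul_mx_row row_mx_eq0.
  by rewrite sub_capmx !sub_kermx.
by rewrite mxrank_ker subnK // rank_leq_row.
Qed.

Section BaseChange.
Variables (C F : fieldType) (h : {rmorphism C -> F}) (n d : nat).
Variables (B : 'I_d -> 'M[C]_n) (S : 'I_d -> 'M[C]_d).
Local Notation "M ^h" := (map_mx h M) (at level 2).
Local Notation B' := (fun i => (B i)^h).
Local Notation S' := (fun i => (S i)^h).

Lemma lie_basis_map : lie_basis B S -> lie_basis B' S'.
Proof.
by move=> lieB i j; rewrite -map_row -map_lincomb lieB map_mxB !map_mxM.
Qed.

Lemma gram_map : gram B' = (gram B)^h.
Proof. by apply/matrixP => i j; rewrite !mxE -map_mxM trace_map_mx. Qed.

Lemma lie_automorphism_map (s : 'M[C]_d) :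
    (forall c v : 'rV_d, (v *m s) *m lincomb S (c *m s) = v *m lincomb S c *m s) ->
  forall c v : 'rV_d,
    (v *m s^h) *m lincomb S' (c *m s^h) = v *m lincomb S' c *m s^h.
Proof.
move=> slie c v; rewrite -!mulmxA; congr (v *m _).
have key i : s^h *m lincomb S' (row i s^h) = (S i)^h *m s^h.
  rewrite -map_row -map_lincomb -!map_mxM; congr (_^h).
  apply/row_matrixP => j; rewrite !row_mul !rowE -mulmxA.
  have := slie (delta_mx 0 i) (delta_mx 0 j).
  by rewrite lincomb_delta -!mulmxA.
rewrite (mulmx_sum_row c) [lincomb _ (\sum_i _)]linear_sum mulmx_sumr.
rewrite [lincomb _ c]/lincomb mulmx_suml.
by apply: eq_bigr => i _; rewrite linearZ /= -scalemxAr key scalemxAl.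
Qed.
End BaseChange.

(** Invariance of the trace form makes the adjoint action of [z] skew for it. *)
Lemma rank_adm_even (F : fieldType) n d (B : 'I_d -> 'M[F]_n) (S : 'I_d -> 'M[F]_d) z :
    2%:R != 0 :> F -> gram B \in unitmx ->
    (forall c v, lincomb B (v *m lincomb S c) =
       lincomb B c *m lincomb B v - lincomb B v *m lincomb B c) ->
  ~~ odd (\rank (lincomb S z)).
Proof.
move=> char2 Bu lieB.
have -> : \rank (lincomb S z) = \rank (lincomb S z *m gram B).
  by rewrite mxrankMfree // row_free_unit.
apply: skew_rank_even char2 _.
have entry (i j : 'I_d) : (lincomb S z *m gram B) i j =
    \tr ((lincomb B z *m B i - B i *m lincomb B z) *m B j).
  have := gramE B (delta_mx 0 i *m lincomb S z) (delta_mx 0 j).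
  rewrite lieB !lincomb_delta => ->.
  by rewrite trmx_delta -colE -!mulmxA -rowE !mxE.
apply/matrixP => i j; rewrite mxE [RHS]mxE !entry !mulmxBl !linearB /= opprB.
congr (_ - _); first by rewrite mxtrace_mulC mulmxA.
by rewrite -mulmxA mxtrace_mulC.
Qed.

Lemma eq_lincomb (R : comNzRingType) d m n (B B' : 'I_d -> 'M[R]_(m, n)) c :
  B =1 B' -> lincomb B c = lincomb B' c.
Proof. by move=> BB'; apply: eq_bigr => i _; rewrite BB'. Qed.

Lemma map_lincomb_comp (R R1 R2 : comNzRingType) (f : {rmorphism R -> R1})
    (g : {rmorphism R1 -> R2}) (h : {rmorphism R -> R2}) d m n
    (B : 'I_d -> 'M[R]_(m, n)) c :
  (forall x, g (f x) = h x) ->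
  map_mx g (lincomb (fun i => map_mx f (B i)) c) =
  lincomb (fun i => map_mx h (B i)) (map_mx g c).
Proof.
move=> gf; rewrite map_lincomb; apply: eq_lincomb => i.
by rewrite -map_mx_comp; apply/matrixP => j k; rewrite !mxE /= gf.
Qed.

Lemma map_mx_comp_ext (R R1 R2 : nzRingType) (f : R -> R1) (g : R1 -> R2)
    (h : R -> R2) m n (M : 'M[R]_(m, n)) :
  (forall x, g (f x) = h x) -> map_mx g (map_mx f M) = map_mx h M.
Proof. by move=> gf; apply/matrixP => i j; rewrite !mxE gf. Qed.

Section Generic.
Variables (C : fieldType) (n d N : nat).
Variables (B : 'I_d -> 'M[C]_n) (S : 'I_d -> 'M[C]_d) (W : 'M[C]_(N, d)).
Local Notation G := (gram B).
Local Notation A := {mpoly C[N]}.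
Local Notation frac := (@FracField.tofrac {mpoly C[N]}).
Hypothesis char0 : forall k, k.+1%:R != 0 :> C.
Hypothesis lieB : lie_basis B S.
Hypothesis gram_unit : G \in unitmx.

Let iota : {rmorphism C -> {fraction A}} := frac \o @mpolyC N C.
(** The generic point of the row space of [W], with the variables as coordinates. *)
Let xA : 'rV[A]_d := (\row_i 'X_i) *m map_mx (@mpolyC N C) W.
Let PA : 'M[A]_d := lincomb (fun i => map_mx (@mpolyC N C) (S i)) xA.

Lemma map_generic_point (F : fieldType) (g : {rmorphism A -> F}) (h : {rmorphism C -> F}) :
  (forall c, g c%:MP = h c) ->
  map_mx g xA = (\row_i g 'X_i) *m map_mx h W.
Proof.
move=> gh; rewrite map_mxM (map_mx_comp_ext _ gh); congr (_ *m _).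
by apply/rowP => i; rewrite !mxE.
Qed.

Lemma meval_generic_point (v : 'I_N -> C) : map_mx (meval v) xA = (\row_i v i) *m W.
Proof.
rewrite (@map_generic_point _ _ idfun) => [|c]; last exact: mevalC.
rewrite map_mx_id //; congr (_ *m _); apply/rowP => i; rewrite !mxE; exact: mevalXU.
Qed.

Lemma meval_generic_adm (v : 'I_N -> C) :
  map_mx (meval v) PA = lincomb S ((\row_i v i) *m W).
Proof.
rewrite (@map_lincomb_comp _ _ _ _ _ idfun) => [|c]; last exact: mevalC.
rewrite meval_generic_point; apply: eq_lincomb => i.
by rewrite map_mx_id.
Qed.

Lemma char0_ext (F : fieldType) (h : {rmorphism C -> F}) k : k.+1%:R != 0 :> F.
Proof. by rewrite -(rmorph_nat h) fmorph_eq0. Qed.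

Lemma exists_natural_rank m p (P : 'M[A]_(m, p)) :
  exists v : 'I_N -> nat,
    (\rank (map_mx frac P) <= \rank (map_mx (meval (fun i => (v i)%:R)) P))%N.
Proof.
have /rank_map_fraction[f [g fg]] := leqnn (\rank (map_mx frac P)).
have [v vfg] := mpoly_nonroot char0 fg; exists v; apply/rank_minorP; exists f, g.
by rewrite -map_mxsub det_map_mx.
Qed.

(** A derivation acting as the [j]-th partial derivative moves the generic point in the direction of
    row [j] of [W]. *)
Lemma derivation_generic_point (F : fieldType) (g : {rmorphism A -> F})
    (h : {rmorphism C -> F}) (D : F -> F) j :
    (forall c, g c%:MP = h c) -> derivation D -> (forall c, D (h c) = 0) ->
    (forall i, D (g 'X_i) = (i == j)%:R) ->
  map_mx D (map_mx g xA) = row j (map_mx h W).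
Proof.
move=> gh derD Dh DX; rewrite (map_generic_point gh) (derivation_mulmx derD).
have -> : map_mx D (map_mx h W) = 0 by apply/matrixP => i k; rewrite !mxE Dh.
rewrite mulmx0 addr0 rowE; congr (_ *m _).
by apply/rowP => i; rewrite !mxE DX.
Qed.

(** The nullity at the generic point of [W] is at most that at [x1 *m W], so [rank_adm_le_generic]
    applies there with the partial derivatives; suitable natural coordinates then preserve the
    rank. *)
Lemma rank_adm_le_natural c (Z : 'M[C]_(c, d)) (x1 : 'rV[C]_N) (z0 : 'rV[C]_d) :
    row_free Z -> (forall i, Z *m S i = 0) -> Z *m G *m W^T = 0 ->
    (nullity B S (x1 *m W) W <= c)%N ->
  exists v : 'I_N -> nat,
    (\rank (lincomb S z0) <= \rank (lincomb S ((\row_i (v i)%:R) *m W)))%N.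
Proof.
move=> Zfree ZS ZW nullx1.
have [v vP] := exists_natural_rank PA; exists v.
rewrite meval_generic_adm in vP; apply: leq_trans vP.
have [D [derD DC DX]] := function_field_derivations C N.
have PAE : map_mx frac PA = lincomb (fun i => map_mx iota (S i)) (map_mx frac xA).
  exact: map_lincomb_comp.
rewrite PAE -(mxrank_map iota) map_lincomb.
have LL := @rank_adm_le_generic _ _ _ _ _ (char0_ext iota)
  (lincomb_lie_basis (lie_basis_map iota lieB)) _ N (map_mx iota W) (map_mx frac xA) D c
   (map_mx iota Z) (map_mx iota z0). apply: LL => //.
- by rewrite gram_map map_unitmx.
- move=> i; rewrite (map_lincomb_derivation _ (derD i)); last by move=> j k l; rewrite mxE DC.
  congr (lincomb _ _); exact: (@derivation_generic_point _ frac iota (D i) i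
    (fun=> erefl) (derD i) (DC i) (DX^~ i)).
- by rewrite row_free_map.
- move=> z; rewrite /lincomb mulmx_sumr big1 // => i _.
  by rewrite -scalemxAr -map_mxM ZS map_mx0 scaler0.
- by rewrite gram_map map_trmx -!map_mxM ZW map_mx0.
move: nullx1; rewrite /nullity -PAE gram_map map_trmx -map_mxM.
(* The corank of [Q] is the nullity, and its rank can only drop at [x1]. *)
pose Q : 'M[A]_(d, d + N) := row_mx PA (map_mx (@mpolyC N C) (G *m W^T)).
have Qfrac : map_mx frac Q = row_mx (map_mx frac PA) (map_mx iota (G *m W^T)).
  by rewrite map_row_mx (map_mx_comp_ext (h := iota)).
have Qx1 : map_mx (meval (x1 0)) Q = row_mx (lincomb S (x1 *m W)) (G *m W^T).
  rewrite map_row_mx meval_generic_adm (map_mx_comp_ext (h := idfun)) => [|y].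
    rewrite map_mx_id //; congr (row_mx (lincomb S (_ *m _)) _).
    by apply/rowP => i; rewrite mxE.
  exact: mevalC.
have := rank_cap_ker (map_mx frac PA) (map_mx iota (G *m W^T)).
have := rank_cap_ker (lincomb S (x1 *m W)) (G *m W^T).
rewrite -Qfrac -Qx1; have := rank_map_le_fraction (meval (x1 0)) Q.
move=> r1K e1 eK n1; rewrite -(leq_add2r (\rank (map_mx frac Q))).
exact: leq_trans (eq_leq (etrans eK (esym e1))) (leq_add n1 r1K).
Qed.
End Generic.

(** * Centralisers along a whole pencil *)

Section RegularPencil.
Variables (C : fieldType) (n d N : nat).
Variables (B : 'I_d -> 'M[C]_n) (S : 'I_d -> 'M[C]_d) (Mt : 'M[C]_(N, d)).
Local Notation G := (gram B).
Local Notation A := {mpoly C[N]}.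
Local Notation frac := (@FracField.tofrac {mpoly C[N]}).
Hypothesis char0 : forall k, k.+1%:R != 0 :> C.
Hypothesis lieB : lie_basis B S.
Hypothesis gram_unit : G \in unitmx.
Variable s : 'M[C]_d.
Hypothesis s_inv : s *m s = 1%:M.
Hypothesis s_lie : forall c v : 'rV_d,
  (v *m s) *m lincomb S (c *m s) = v *m lincomb S c *m s.
Hypothesis s_isom : s *m G *m s^T = G.
Variable a : 'rV[C]_d.
Hypothesis Mt_s : Mt *m s = Mt.
Hypothesis a_s : a *m s = - a.
Hypothesis orth_Mt_commute :
  (kermx (s - 1%:M) :&: kermx (G *m Mt^T) <= kermx (lincomb S a))%MS.

Let xA : 'rV[A]_d := (\row_i 'X_i) *m map_mx (@mpolyC N C) Mt.

(** The root [z] plays the role of the algebraic function [lambda(x)] at which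
    [x + lambda a] would be singular for generic [x]. *)
Lemma generic_pencil_regular (L : fieldType) (f : {rmorphism {fraction A} -> L}) z
    (h : {rmorphism C -> L}) (x1 : 'rV[C]_N) :
    extends_derivations f -> (forall c, f (frac c%:MP) = h c) ->
  (\rank (lincomb S (x1 *m Mt)) <=
   \rank (lincomb (fun i => map_mx h (S i))
            (map_mx (f \o frac) xA + z *: map_mx h a)))%N.
Proof.
move=> fD fh; set x := map_mx _ xA; set y := x + _.
have char0L := char0_ext char0 h.
have lieL := lincomb_lie_basis (lie_basis_map h lieB).
have gramL : gram (fun i => map_mx h (B i)) \in unitmx by rewrite gram_map map_unitmx.
have rx : (\rank (lincomb S (x1 *m Mt)) <=
    \rank (lincomb (fun i => map_mx h (S i)) x))%N.
  pose PA := lincomb (fun i => map_mx (@mpolyC N C) (S i)) xA.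
  have <- : map_mx (f \o frac) PA = lincomb (fun i => map_mx h (S i)) x.
    exact: map_lincomb_comp.
  have -> : map_mx (f \o frac) PA = map_mx f (map_mx frac PA).
    by apply/matrixP => i j; rewrite !mxE.
  rewrite mxrank_map; apply: leq_trans (rank_map_le_fraction (meval (x1 0)) PA).
  rewrite meval_generic_adm (_ : \row_i x1 0 i = x1) //.
  by apply/rowP => i; rewrite mxE.
have [z0|z0] := eqVneq z 0; first by rewrite /y z0 scale0r addr0.
have [D [derD DC DX]] := function_field_derivations C N.
have /choice[D' D'P] : forall j, exists D', derivation D' /\ forall u, D' (f u) = f (D j u).
  by move=> j; have [D' derD' D'E] := fD _ (derD j); exists D'.
have derD' j : derivation (D' j) := (D'P j).1.
have D'h j c : D' j (h c) = 0 by rewrite -fh (D'P j).2 DC rmorph0.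
have orthL (u : 'rV[L]_d) : u *m map_mx h s = u ->
    u *m gram (fun i => map_mx h (B i)) *m (map_mx h Mt)^T = 0 ->
    u *m lincomb (fun i => map_mx h (S i)) (map_mx h a) = 0.
  move=> us uM; rewrite -map_lincomb; apply/sub_kermxP.
  rewrite -map_kermx; apply: submx_trans (_ : _ <= map_mx h _)%MS _; last first.
    by rewrite (map_submx h); exact: orth_Mt_commute.
  rewrite map_capmx !map_kermx sub_capmx; apply/andP; split; apply/sub_kermxP.
    by rewrite map_mxB map_mx1 mulmxBr mulmx1 us subrr.
  by rewrite map_mxM -map_trmx -gram_map mulmxA.
have Dy i : map_mx (D' i) (lincomb (fun i => map_mx h (B i)) y) =
    lincomb (fun i => map_mx h (B i)) (row i (map_mx h Mt) + D' i z *: map_mx h a).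
  rewrite (map_lincomb_derivation _ (derD' i)) => [|j k l]; last by rewrite mxE D'h.
  congr (lincomb _ _).
  rewrite -(@derivation_generic_point _ _ _ _ _ (f \o frac) h (D' i) i) //.
    by apply/rowP => k; rewrite !mxE (derD' i).1 (derD' i).2 D'h mulr0 addr0 mulrC.
  by move=> j; rewrite (D'P i).2 DX rmorph_nat.
have := pencil_regular char0L lieL gramL
  (_ : map_mx h s *m map_mx h s = 1%:M) (lie_automorphism_map h s_lie)
  (_ : _ = _) (_ : map_mx h Mt *m map_mx h s = map_mx h Mt)
  (_ : map_mx h a *m map_mx h s = - map_mx h a) orthL (_ : x *m map_mx h s = x)
  z0 derD' Dy.
rewrite gram_map map_trmx -!map_mxM s_inv s_isom Mt_s a_s map_mx1 map_mxN.
have xs : x *m map_mx h s = x.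
  by rewrite /x (@map_generic_point _ _ _ _ _ _ h) // -mulmxA -map_mxM Mt_s.
move=> /(_ erefl erefl erefl erefl xs).
(* The bound of [pencil_regular] may be off by one; the ranks at [x1 *m Mt] and at [y] are both
   even, which removes the defect. *)
have oy := rank_adm_even y (char0L 1) gramL lieL.
have o1 := rank_adm_even (x1 *m Mt) (char0 1) gram_unit (lincomb_lie_basis lieB).
move: rx oy o1; rewrite -/y.
move: (\rank (lincomb S _)) (\rank (lincomb _ x)) (\rank (lincomb _ y)); lia.
Qed.

(** On the pencil through the generic point the minors of order [r] are polynomials in the
    parameter. A common factor would have a root in an extension, against [generic_pencil_regular];
    so [bezout_family_fraction] yields [e], and a point where [e] does not vanish serves for every
    [l] at once. *)
Theorem exists_regular_pencil (x1 : 'rV[C]_N) :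
  exists v : 'I_N -> nat, forall l,
    (\rank (lincomb S (x1 *m Mt)) <=
     \rank (lincomb S ((\row_i (v i)%:R) *m Mt + l *: a)))%N.
Proof.
set r := \rank _.
pose hA : {rmorphism C -> {poly A}} := polyC \o @mpolyC N C.
pose P := lincomb (fun i => map_mx hA (S i)) (map_mx polyC xA + 'X *: map_mx hA a).
pose I := ({ffun 'I_r -> 'I_d} * {ffun 'I_r -> 'I_d})%type.
pose q (i : I) := \det (mxsub i.1 i.2 P).
have mapP (F : fieldType) (e : {rmorphism {poly A} -> F}) (h : {rmorphism C -> F}) :
    (forall c, e (c%:MP)%:P = h c) ->
    map_mx e P = lincomb (fun i => map_mx h (S i))
      (map_mx (e \o polyC) xA + e 'X *: map_mx h a).
  move=> eh; rewrite (map_lincomb_comp (h := h)) //; congr (lincomb _ _).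
  apply/rowP => i; rewrite !mxE rmorphD rmorphM /=; congr (_ + _ * _).
  exact: eh.
have qP (F : fieldType) (e : {rmorphism {poly A} -> F}) :
    (r <= \rank (map_mx e P))%N <-> exists i, e (q i) != 0.
  split=> [/rank_minorP[f [g fg]]|[[f g]]].
    exists (finfun f, finfun g); rewrite /q -det_map_mx map_mxsub.
    rewrite (_ : mxsub _ _ _ = mxsub f g (map_mx e P)) //.
    by apply/matrixP => i j; rewrite !mxE !ffunE.
  by rewrite /q -det_map_mx map_mxsub => fg; apply/rank_minorP; exists f, g.
have ev0 v l c : (horner_eval l \o map_poly (meval v)) (c%:MP)%:P = c :> C.
  by rewrite /= map_polyC /horner_eval hornerC; apply: mevalC.
have evP v l : map_mx (horner_eval l \o map_poly (meval v)) P =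
    lincomb S ((\row_i v i) *m Mt + l *: a).
  rewrite (mapP _ _ idfun) => [|c]; last exact: ev0.
  rewrite map_mx_id // /= map_polyX /horner_eval hornerX.
  rewrite (eq_lincomb (B' := S)) => [|i]; last by rewrite map_mx_id.
  rewrite -(meval_generic_point); congr (lincomb _ (_ + _)).
  by apply/matrixP => i j; rewrite !mxE /= map_polyC hornerC.
(* At the point [x1] with parameter [0] some minor is nonzero. *)
have [i0 qi0] : exists i, q i != 0.
  have /qP[i qi] : (r <= \rank (map_mx (horner_eval 0%R \o map_poly (meval (x1 0%R))) P))%N.
    rewrite evP scale0r addr0 (_ : \row_i x1 0 i = x1) //.
    by apply/rowP => i; rewrite mxE.
  by exists i; apply: contra_neq qi => ->; rewrite rmorph0.
have [[g g1 gq]|[e e0 [b be]]] := bezout_family_fraction (ex_intro _ i0 qi0).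
  have charK := char0_ext char0 (frac \o @mpolyC N C).
  have [L [f [z [gz fD]]]] := adjoin_root charK g1.
  pose h : {rmorphism C -> L} := f \o (frac \o @mpolyC N C).
  pose e : {rmorphism {poly A} -> L} := horner_eval z \o map_poly (f \o frac).
  have /qP[i /negP[]] : (r <= \rank (map_mx e P))%N.
    rewrite (mapP _ e h) => [|c]; last by rewrite /= map_polyC /horner_eval hornerC.
    rewrite /= map_polyX /horner_eval hornerX.
    rewrite (_ : map_mx _ xA = map_mx (f \o frac) xA).
      exact: generic_pencil_regular.
    by apply/matrixP => i j; rewrite !mxE /= map_polyC hornerC.
  have /dvdpP[u uE] := gq i.
  rewrite /e /= /horner_eval map_poly_comp uE rmorphM hornerM.
  by rewrite (eqP gz) mulr0.
have [v ve] := mpoly_nonroot char0 e0; exists v => l; rewrite -evP; apply/qP.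
apply/existsP; apply: contraNT ve => /existsPn q0.
have := congr1 (horner_eval l \o map_poly (meval (fun i => (v i)%:R))) be.
rewrite rmorph_sum big1 => [|i _].
  by rewrite /= map_polyC /horner_eval hornerC => <-.
rewrite rmorphM; have := q0 i; rewrite negbK => /eqP ->.
by rewrite mulr0.
Qed.
End RegularPencil.

(** * Coordinates on real and complexified Lie algebras *)

Lemma min_dim_le (K : fieldType) (V : vectType K) (U : {vspace V})
    (F : V -> {vspace V}) y : y \in U -> (min_dim U F <= \dim (F y))%N.
Proof.
move=> yU; rewrite /min_dim; case: ex_minnP => m _; apply.
by apply/asboolP; exists y.
Qed.

Lemma mem_leigenspace (K : fieldType) (V : vectType K) (f : 'End(V)) c x :
  (x \in passmx.leigenspace f c) = (f x == c *: x).
Proof. by rewrite memv_ker add_lfunE opp_lfunE scale_lfunE id_lfunE subr_eq0. Qed.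

Section VspaceMatrix.
Variables (K : fieldType) (V : vectType K) (d : nat) (crd : {linear V -> 'rV[K]_d}).
Implicit Type U : {vspace V}.
Hypothesis crd_inj : injective crd.

Definition vspace_mx U : 'M_(\dim U, d) := \matrix_i crd (vbasis U)`_i.

Lemma mul_vspace_mx U (w : 'rV_(\dim U)) :
  w *m vspace_mx U = crd (\sum_i w 0 i *: (vbasis U)`_i).
Proof.
rewrite mulmx_sum_row linear_sum; apply: eq_bigr => i _.
by rewrite linearZ rowK.
Qed.

Lemma vspace_mx_free U : row_free (vspace_mx U).
Proof.
rewrite -kermx_eq0; apply/rowV0P => w /sub_kermxP; rewrite mul_vspace_mx.
rewrite -(linear0 crd) => /crd_inj w0; apply/rowP => i; rewrite mxE.
by have /freeP/(_ (w 0) w0) := basis_free (vbasisP U).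
Qed.

Lemma mem_sum_vbasis U (c : 'I_(\dim U) -> K) : \sum_i c i *: (vbasis U)`_i \in U.
Proof.
by apply: memv_suml => i _; rewrite memvZ // vbasis_mem // mem_nth // size_tuple.
Qed.

Lemma mem_vspace_mx U x : (crd x <= vspace_mx U)%MS = (x \in U).
Proof.
apply/idP/idP => [/submxP[w]|xU].
  by rewrite mul_vspace_mx => /crd_inj ->; apply: mem_sum_vbasis.
rewrite (coord_vbasis xU).
have -> : crd (\sum_i coord (vbasis U) i x *: (vbasis U)`_i)
    = (\row_i coord (vbasis U) i x) *m vspace_mx U.
  by rewrite mul_vspace_mx; congr (crd _); apply: eq_bigr => i _; rewrite mxE.
exact: submxMl.
Qed.

Lemma dim_coordinates U p (A : 'M[K]_(p, d)) : (forall u, exists x, crd x = u) ->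
  (forall x, (crd x <= A)%MS = (x \in U)) -> \rank A = \dim U.
Proof.
move=> crd_surj AU; rewrite -(eqP (vspace_mx_free U)); apply: eqmx_rank.
apply/andP; split; apply/rV_subP => u; have [x <-] := crd_surj u.
  by rewrite AU mem_vspace_mx.
by rewrite mem_vspace_mx AU.
Qed.
End VspaceMatrix.

Section Coordinates.
Variables (K : fieldType) (V : vectType K).

Definition coordinates (x : V) : 'rV[K]_(\dim {:V}) :=
  \row_i coord (vbasis {:V}) i x.

Lemma coordinates_linear : linear coordinates.
Proof. by move=> k x y; apply/rowP => i; rewrite !mxE linearP. Qed.
HB.instance Definition _ :=
  GRing.isLinear.Build K V 'rV[K]_(\dim {:V}) _ coordinates coordinates_linear.

Lemma coordinates_sum x : x = \sum_i coordinates x 0 i *: (vbasis {:V})`_i.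
Proof. by rewrite {1}(coord_vbasis (memvf x)); apply: eq_bigr => i _; rewrite mxE. Qed.

Lemma coordinates_inj : injective coordinates.
Proof. by move=> x y xy; rewrite (coordinates_sum x) xy -coordinates_sum. Qed.

Lemma coordinates_eq0 x : (coordinates x == 0) = (x == 0).
Proof. by rewrite -(linear0 coordinates) (inj_eq coordinates_inj). Qed.

Lemma coordinates_surj u : exists x, coordinates x = u.
Proof.
exists (\sum_i u 0 i *: (vbasis {:V})`_i); apply/rowP => j; rewrite mxE.
by rewrite coord_sum_free // (basis_free (vbasisP _)).
Qed.
End Coordinates.

Section LieCoordinates.
Variables (R : fieldType) (g : lieAlgebraType R).
Local Notation d := (\dim {:g}).
Local Notation e := (vbasis {:g}).
Local Notation crd := (@coordinates R g).

Definition structure_mx (i : 'I_d) : 'M[R]_d :=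
  \matrix_(j, k) coord e k (lie e`_i e`_j).

Lemma crd_lie x y : crd (lie x y) = crd y *m lincomb structure_mx (crd x).
Proof.
have adE (i : 'I_d) : crd (ad e`_i y) = crd y *m structure_mx i.
  rewrite {1}(coordinates_sum y) !linear_sum mulmx_sum_row; apply: eq_bigr => j _ /=.
  rewrite !linearZ /= lfunE; congr (_ *: _).
  by apply/rowP => k; rewrite !mxE.
have -> : lie x y = ad x y by rewrite lfunE.
rewrite {1}(coordinates_sum x) linear_sum sum_lfunE linear_sum /lincomb mulmx_sumr.
apply: eq_bigr => i _ /=; rewrite linearZ scale_lfunE linearZ /= adE.
by rewrite scalemxAr.
Qed.

Lemma rank_lie_cent x :
  (\dim (lie_cent x) + \rank (lincomb structure_mx (crd x)))%N = d.
Proof.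
rewrite -(dim_coordinates (@coordinates_inj _ g) (U := lie_cent x)
  (A := kermx (lincomb structure_mx (crd x))) (@coordinates_surj _ g)) => [|y].
  by rewrite mxrank_ker subnK // rank_leq_row.
by rewrite sub_kermx -crd_lie mem_lie_cent coordinates_eq0.
Qed.

End LieCoordinates.

(** * Orthogonality for the definite trace form *)

Section DefiniteRepresentation.
Variables (R : realFieldType) (g : lieAlgebraType R).
Local Notation d := (\dim {:g}).
Local Notation e := (vbasis {:g}).
Local Notation crd := (@coordinates R g).
Variables (n : nat) (chi : {linear g -> 'M[R]_n}).
Hypothesis chi_rep : lie_representation chi.
Hypothesis chi_neg : forall x, x != 0 -> trace_form chi x x < 0.
Local Notation B := (fun i : 'I_d => chi e`_i).

Lemma lincomb_crd x : lincomb B (crd x) = chi x.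
Proof.
rewrite {2}(coordinates_sum x) linear_sum; apply: eq_bigr => i _.
by rewrite linearZ.
Qed.

Lemma lie_basis_chi : lie_basis B (@structure_mx R g).
Proof.
move=> i j; rewrite -chi_rep -lincomb_crd; congr (lincomb _ _).
by apply/rowP => k; rewrite !mxE.
Qed.

Lemma gram_crd x y : (crd x *m gram B *m (crd y)^T) 0 0 = trace_form chi x y.
Proof. by rewrite -gramE !lincomb_crd. Qed.

Lemma gram_chi_unit : gram B \in unitmx.
Proof.
rewrite -row_free_unit -kermx_eq0; apply/rowV0P => u /sub_kermxP.
have [x <-] := @coordinates_surj _ g u => x0; apply/eqP; rewrite coordinates_eq0.
have := gram_crd x x; rewrite x0 mul0mx mxE => xx.
by apply: contraT => /chi_neg; rewrite -xx Order.POrderTheory.ltxx.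
Qed.

(** The orthogonal projection onto [U] exists because the form is definite. *)
Lemma orthov_orthov (U : {vspace g}) x :
  (forall y, (forall u, u \in U -> trace_form chi y u = 0) -> trace_form chi x y = 0) ->
  x \in U.
Proof.
move=> xU; pose b := vbasis U; pose T := trace_form chi.
have Tsum y (c : 'I_(\dim U) -> R) :
    T y (\sum_i c i *: b`_i) = \sum_i c i * T y b`_i.
  rewrite /T /trace_form linear_sum mulmx_sumr linear_sum; apply: eq_bigr => i _.
  by rewrite linearZ /= -scalemxAr linearZ.
have Tsym y z : T y z = T z y by rewrite /T /trace_form mxtrace_mulC.
have TB y z w : T (y - z) w = T y w - T z w.
  by rewrite /T /trace_form linearB /= mulmxBl linearB.
pose P : 'M_(\dim U) := \matrix_(i, j) T b`_i b`_j.
have Pu : P \in unitmx.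
  rewrite -row_free_unit -kermx_eq0; apply/rowV0P => w /sub_kermxP wP.
  pose y := \sum_i w 0 i *: b`_i.
  have yb (j : 'I_(\dim U)) : T y b`_j = 0.
    have := congr1 (fun M : 'rV_(\dim U) => M 0 j) wP; rewrite !mxE => <-.
    by rewrite Tsym Tsum; apply: eq_bigr => i _; rewrite mxE Tsym.
  have y0 : y = 0.
    apply/eqP; apply: contraT => /chi_neg.
    rewrite -/(T y y) {2}/y Tsum big1 ?Order.POrderTheory.ltxx //.
    by move=> i _; rewrite yb mulr0.
  apply/rowP => i; rewrite mxE.
  by have /freeP/(_ (w 0) y0) := basis_free (vbasisP U).
pose c := (\row_j T x b`_j) *m invmx P.
pose p := \sum_i c 0 i *: b`_i.
have pU : p \in U by apply: mem_sum_vbasis.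
have orth u : u \in U -> T (x - p) u = 0.
  move=> uU; rewrite (coord_vbasis uU) Tsum big1 // => j _.
  rewrite TB Tsym [T p _]Tsym Tsum.
  have : (c *m P) 0 j = T x b`_j by rewrite mulmxKV // mxE.
  rewrite mxE Tsym => <-; rewrite [X in X - _](eq_bigr (fun i => c 0 i * T b`_j b`_i)).
    by rewrite subrr mulr0.
  by move=> i _; congr (_ * _); rewrite mxE Tsym.
have : T (x - p) (x - p) = 0.
  have Tx : T x (x - p) = 0 := xU _ orth.
  by rewrite TB Tx [T p _]Tsym orth // subrr.
have [/eqP|/chi_neg] := eqVneq (x - p) 0; first by rewrite subr_eq0 => /eqP ->.
by rewrite -/(T _ _) => /[swap] ->; rewrite Order.POrderTheory.ltxx.
Qed.
End DefiniteRepresentation.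

(** * Coordinates on the complexification *)

Section ComplexCoordinates.
Variables (R : rcfType) (V : vectType R).
Local Notation VC := (complexification V).
Local Notation C := R[i].
Local Notation d := (\dim {:V}).
Local Notation e := (vbasis {:V}).
Local Notation iota := (real_complex R).

(** Coordinates in the real basis, so that the structure matrices of the complexification are the
    images of the real ones. *)
Definition complex_coordinates (z : VC) : 'rV[C]_d :=
  \row_i (coord e i z.1 +i* coord e i z.2)%C.

Lemma complex_coordinates_linear : linear complex_coordinates.
Proof.
move=> [a b] [x y] [z w]; apply/rowP => i; rewrite !mxE /=.
rewrite !(linearB, linearD, linearZ) /=; apply/eqP.
by rewrite eq_complex /= [b * _ + _]addrC !eqxx.
Qed.
HB.instance Definition _ :=
  GRing.isLinear.Build C VC 'rV[C]_d _ complex_coordinates complex_coordinates_linear.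

Lemma complex_coordinatesE z : complex_coordinates z =
  map_mx iota (coordinates z.1) + 'i%C *: map_mx iota (coordinates z.2).
Proof.
apply/rowP => i; rewrite !mxE; apply/eqP.
by rewrite eq_complex /= !mul0r mul1r mul1r subrr addr0 !add0r !eqxx.
Qed.

Lemma complex_coordinates_toC x : complex_coordinates (toC x) = map_mx iota (coordinates x).
Proof. by rewrite complex_coordinatesE /= linear0 map_mx0 scaler0 addr0. Qed.

Lemma complex_coordinates_inj : injective complex_coordinates.
Proof.
move=> [x y] [x' y'] /rowP xy; congr (_, _); apply: coordinates_inj; apply/rowP => i.
  by have := congr1 (@complex.Re R) (xy i); rewrite !mxE.
by have := congr1 (@complex.Im R) (xy i); rewrite !mxE.
Qed.

Lemma complex_coordinates_surj u : exists z, complex_coordinates z = u.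
Proof.
have [x xE] := coordinates_surj (map_mx (@complex.Re R) u : 'rV[R]_d).
have [y yE] := coordinates_surj (map_mx (@complex.Im R) u : 'rV[R]_d).
exists (x, y); apply/rowP => i; rewrite mxE /=.
have := congr1 (fun M : 'rV[R]_d => M 0 i) xE.
have := congr1 (fun M : 'rV[R]_d => M 0 i) yE.
by rewrite !mxE => -> ->; case: (u 0 i).
Qed.
End ComplexCoordinates.

Section ComplexLie.
Variables (R : rcfType) (g : lieAlgebraType R).
Local Notation iota := (real_complex R).
Local Notation crd := (@complex_coordinates R g).
Local Notation SC := (fun i => map_mx (real_complex R) (@structure_mx R g i)).

Lemma complex_coordinates_lie (z w : complexification g) :
  crd (lie z w) = crd w *m lincomb SC (crd z).
Proof.
rewrite !complex_coordinatesE /= linearB linearD /= !crd_lie.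
rewrite linearD linearZ /= -!map_lincomb mulmxDl !mulmxDr -!scalemxAl -!scalemxAr.
rewrite map_mxB map_mxD !map_mxM /= !scalerDr !scalerA.
have -> : ('i * 'i)%C = -1 :> R[i] by rewrite -expr2 sqr_i.
rewrite scaleN1r addrACA -addrA [RHS]addrACA -[RHS]addrA.
by congr (_ + (_ + _)); rewrite addrC.
Qed.

Lemma rank_complex_lie_cent (z : complexification g) :
  (\dim (lie_cent z) + \rank (lincomb SC (crd z)))%N = \dim {:g}.
Proof.
rewrite -(dim_coordinates (@complex_coordinates_inj _ g) (U := lie_cent z)
  (A := kermx (lincomb SC (crd z))) (@complex_coordinates_surj _ g)) => [|w].
  by rewrite mxrank_ker subnK // rank_leq_row.
rewrite sub_kermx -complex_coordinates_lie mem_lie_cent.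
by rewrite -(linear0 crd) (inj_eq (@complex_coordinates_inj _ _)).
Qed.
End ComplexLie.

(** * The involution and the subspaces m and m~ in coordinates *)

Section Main.
Variables (R : realType) (g : lieAlgebraType R) (n : nat).
Variable chi : {linear g -> 'M[R]_n}.
Hypothesis chi_rep : lie_representation chi.
Hypothesis chi_neg : forall x : g, x != 0 -> trace_form chi x x < 0.
Variable sigma : 'End(g).
Hypothesis sigma_aut : lie_automorphism sigma.
Hypothesis sigma_inv : involutive sigma.
Hypothesis sigma_isom : forall x y : g,
  trace_prod chi (sigma x) (sigma y) = trace_prod chi x y.
Variable a : g.
Hypothesis sigma_a : sigma a = - a.

Local Notation T := (trace_form chi).
Local Notation k := (lie_cent a).
Local Notation m := (orthov (trace_prod chi) k).
Local Notation m_plus := (m :&: passmx.leigenspace sigma 1)%VS.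
Local Notation iota := (real_complex R).
Local Notation d := (\dim {:g}).
Local Notation e := (vbasis {:g}).
Local Notation B := (fun i : 'I_d => chi e`_i).
Local Notation S := (@structure_mx R g).
Local Notation adm := (lincomb S).
Local Notation crd := (@coordinates R g).
Local Notation crdC := (@complex_coordinates R g).
Local Notation SC := (fun i => map_mx iota (S i)).

Lemma trace_form_sigma x y : T (sigma x) (sigma y) = T x y.
Proof. by apply: oppr_inj; apply: sigma_isom. Qed.

Lemma mem_m x : x \in m <-> forall z, z \in k -> T x z = 0.
Proof.
split=> [/mem_orthovP xm z /xm|xm].
  by move/eqP; rewrite oppr_eq0 => /eqP.
apply/mem_orthovP => z /xm xz; have : - T x z = 0 by rewrite xz oppr0.
exact.
Qed.

Lemma mem_m_plus x : (x \in m_plus) = (x \in m) && (sigma x == x).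
Proof. by rewrite memv_cap mem_leigenspace scale1r. Qed.

(** [sigma] preserves [k] because it sends [a] to [- a]; being an isometry, it preserves the
    orthogonal complement too. *)
Lemma sigma_m x : x \in m -> sigma x \in m.
Proof.
move=> /mem_m xm; apply/mem_m => z zk.
rewrite -[z]sigma_inv trace_form_sigma; apply: xm.
rewrite mem_lie_cent; move: zk; rewrite mem_lie_cent => /eqP az.
have := sigma_aut.2 a z; rewrite az linear0 sigma_a.
have -> : lie (- a) (sigma z) = - lie a (sigma z).
  by rewrite [LHS]lie_anti linearN opprK [LHS]lie_anti.
by move/eqP; rewrite eq_sym oppr_eq0.
Qed.

Lemma orth_m y : (forall w, w \in m -> T y w = 0) -> y \in k.
Proof. by move=> ym; apply: (orthov_orthov chi_neg) => w /mem_m; apply: ym. Qed.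

Lemma trace_formD x y z : T x (y + z) = T x y + T x z.
Proof. by rewrite /trace_form linearD mulmxDr linearD. Qed.

(** A fixed vector [x] has equal products with [w] and [sigma w], and [w + sigma w] lies in
    [m_plus]; so [x] is orthogonal to all of [m]. *)
Lemma orth_m_plus x : sigma x = x -> (forall w, w \in m_plus -> T x w = 0) -> x \in k.
Proof.
move=> sx xm; apply: orth_m => w wm.
have : T x (w + sigma w) = 0.
  apply: xm; rewrite mem_m_plus memvD ?sigma_m //=.
  by rewrite linearD /= sigma_inv addrC.
rewrite trace_formD -{2}sx trace_form_sigma => /eqP.
by rewrite -mulr2n mulrn_eq0 /= => /eqP.
Qed.

Local Notation U_mx := (vspace_mx crd).
Local Notation s := (\matrix_i crd (sigma e`_i) : 'M[R]_d).
Local Notation G := (gram B).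

Lemma coordinates_sigma x : crd x *m s = crd (sigma x).
Proof.
rewrite {2}(coordinates_sum x) !linear_sum mulmx_sum_row; apply: eq_bigr => i _ /=.
by rewrite !linearZ /= rowK.
Qed.

Lemma coordinates_orth (U : {vspace g}) x :
  crd x *m (G *m (U_mx U)^T) = 0 <-> forall w, w \in U -> T x w = 0.
Proof.
split=> [xU w|xU].
  rewrite -(mem_vspace_mx (@coordinates_inj _ g)) => /submxP[c wE].
  rewrite -gram_crd wE trmx_mul -!mulmxA (mulmxA (crd x)) (mulmxA _ (U_mx U)^T).
  by rewrite -(mulmxA _ G) xU mul0mx mxE.
apply/rowP => i; rewrite [RHS]mxE mulmxA.
have <- := xU (vbasis U)`_i; last by rewrite vbasis_mem // mem_nth // size_tuple.
by rewrite -gram_crd !mxE; apply: eq_bigr => j _; rewrite !mxE.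
Qed.

Lemma coordinates_orth_commute :
  (kermx (s - 1%:M) :&: kermx (G *m (U_mx m_plus)^T) <= kermx (adm (crd a)))%MS.
Proof.
apply/rV_subP => u; have [x <-] := coordinates_surj u.
rewrite sub_capmx !sub_kermx mulmxBr mulmx1 coordinates_sigma -linearB /=.
rewrite coordinates_eq0 subr_eq0 => /andP[/eqP sx /eqP/coordinates_orth xm].
rewrite -crd_lie coordinates_eq0 -mem_lie_cent; exact: orth_m_plus.
Qed.

Lemma coordinates_vbasis (i : 'I_d) : crd e`_i = delta_mx 0 i.
Proof.
apply/rowP => j; rewrite !mxE /= coord_free ?(basis_free (vbasisP _)) //.
by rewrite eq_sym.
Qed.

Lemma lie_center_sub_k z : z \in lie_center g -> z \in k.
Proof.
by move=> /mem_lie_center zC; rewrite mem_lie_cent lie_anti zC oppr0.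
Qed.

(** Two bounds meet. By [exists_regular_pencil] the centralisers along the complex line through [x0]
    have at most the dimension of that of [x1]. Conversely [rank_adm_le_natural] finds, for each
    point of the line, a vector of [m] with no larger centraliser, and [x1] attains the minimum over
    [m]. *)
Lemma exists_uniform_plus x1 :
    x1 \in m_plus -> \dim (lie_cent x1) = min_dim m (@lie_cent R g) ->
    (lie_cent x1 :&: k)%VS = lie_center g ->
  exists2 x0, x0 \in m_plus & forall l : R[i],
    \dim (lie_cent (toC x0 + l *: toC a)) = min_dim m (@lie_cent R g).
Proof.
move=> x1m dimx1 kx1.
have char0 j : j.+1%:R != 0 :> R[i] by rewrite pnatr_eq0.
have lieC := lie_basis_map iota (lie_basis_chi chi_rep).
have gramC : gram (fun i => map_mx iota (B i)) \in unitmx.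
  by rewrite gram_map map_unitmx gram_chi_unit.
have /submxP[c1 c1E] : (crd x1 <= U_mx m_plus)%MS.
  by rewrite (mem_vspace_mx (@coordinates_inj _ g)).
have s_lie (c v : 'rV_d) : (v *m s) *m adm (c *m s) = v *m adm c *m s.
  have [x <-] := coordinates_surj c; have [y <-] := coordinates_surj v.
  by rewrite !coordinates_sigma -!crd_lie coordinates_sigma sigma_aut.2.
have s_inv : s *m s = 1%:M.
  apply/row_matrixP => i; rewrite row_mul rowK coordinates_sigma sigma_inv.
  by rewrite coordinates_vbasis row1.
have s_isom : s *m G *m s^T = G.
  apply/matrixP => i j.
  have entry (M1 M2 : 'M_d) :
      (M1 *m G *m M2^T) i j = (row i M1 *m G *m (row j M2)^T) 0 0.
    rewrite -row_mul [LHS]mxE [RHS]mxE; apply: eq_bigr => l _.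
    by congr (_ * _); rewrite !mxE.
  have -> : G i j = (1%:M *m G *m (1%:M)^T) i j by rewrite trmx1 mulmx1 mul1mx.
  by rewrite !entry !rowK !row1 -!coordinates_vbasis !gram_crd trace_form_sigma.
have Mt_s : U_mx m_plus *m s = U_mx m_plus.
  apply/row_matrixP => i; rewrite row_mul rowK coordinates_sigma.
  have : (vbasis m_plus)`_i \in m_plus by rewrite vbasis_mem // mem_nth // size_tuple.
  by rewrite mem_m_plus => /andP[_ /eqP ->].
have a_s : crd a *m s = - crd a by rewrite coordinates_sigma sigma_a linearN.
have orthC : (kermx (map_mx iota s - 1%:M) :&: kermx (gram (fun i => map_mx iota (B i)) *m
    (map_mx iota (U_mx m_plus))^T) <= kermx (lincomb SC (map_mx iota (crd a))))%MS.
  rewrite gram_map map_trmx -map_mxM -(map_mx1 iota) -map_mxB -map_lincomb.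
  by rewrite -!map_kermx -map_capmx map_submx coordinates_orth_commute.
have [||||v vreg] := exists_regular_pencil char0 lieC gramC (s := map_mx iota s) _
  (lie_automorphism_map iota s_lie) _ _ _ orthC (map_mx iota c1).
- by rewrite -map_mxM s_inv map_mx1.
- by rewrite gram_map map_trmx -!map_mxM s_isom.
- by rewrite -map_mxM Mt_s.
- by rewrite -map_mxM a_s map_mxN.
(* Natural coordinates make [x0] a real vector, although the pencil was treated over [R[i]]. *)
pose x0 := \sum_i (v i)%:R *: (vbasis m_plus)`_i.
exists x0; first exact: mem_sum_vbasis.
move=> l; set z := toC x0 + l *: toC a.
have zE : crdC z = (\row_i (v i)%:R) *m map_mx iota (U_mx m_plus) + l *: map_mx iota (crd a).
  rewrite linearD linearZ /= !complex_coordinates_toC; congr (_ + _).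
  have -> : crd x0 = (\row_i (v i)%:R) *m U_mx m_plus.
    by rewrite mul_vspace_mx; congr (crd _); apply: eq_bigr => i _; rewrite mxE.
  by rewrite map_mxM; congr (_ *m _); apply/rowP => i; rewrite !mxE rmorph_nat.
have dz := rank_complex_lie_cent z; have dx := rank_lie_cent x1.
have zx : (\rank (adm (crd x1)) <= \rank (lincomb SC (crdC z)))%N.
  by rewrite c1E zE -(mxrank_map iota) map_lincomb map_mxM; apply: vreg.
have /submxP[c2 c2E] : (crd x1 <= U_mx m)%MS.
  rewrite (mem_vspace_mx (@coordinates_inj _ g)).
  by move: x1m; rewrite mem_m_plus => /andP[].
(* Here [W] spans [m] and [Z] the centre. Vectors orthogonal to [m] lie in [k], so the nullity at
   [x1] is the dimension of [lie_cent x1 :&: k], which is the centre. *)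
have [||||w wrk] := @rank_adm_le_natural _ _ _ _ _ _ (map_mx iota (U_mx m)) char0 lieC gramC
  (\dim (lie_center g)) (map_mx iota (U_mx (lie_center g))) (map_mx iota c2) (crdC z).
- by rewrite row_free_map vspace_mx_free //; apply: coordinates_inj.
- move=> i; rewrite -map_mxM (_ : _ *m _ = 0) ?map_mx0 //.
  apply/row_matrixP => j; rewrite row_mul rowK row0.
  rewrite -[S i](lincomb_delta S) -coordinates_vbasis -crd_lie lie_anti.
  have /mem_lie_center -> : (vbasis (lie_center g))`_j \in lie_center g.
    by rewrite vbasis_mem // mem_nth // size_tuple.
  by rewrite oppr0 linear0.
- rewrite gram_map map_trmx -!map_mxM -mulmxA (_ : _ *m _ = 0) ?map_mx0 //.
  apply/row_matrixP => j; rewrite row_mul rowK row0.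
  apply/coordinates_orth => y /mem_m ym; rewrite /trace_form mxtrace_mulC; apply: ym.
  by apply: lie_center_sub_k; rewrite vbasis_mem // mem_nth // size_tuple.
- rewrite /nullity gram_map map_trmx -!map_mxM -map_lincomb -c2E -!map_kermx.
  rewrite -map_capmx mxrank_map -kx1.
  rewrite (dim_coordinates (@coordinates_inj _ g) (U := lie_cent x1 :&: k)) //.
    exact: coordinates_surj.
  move=> y; rewrite sub_capmx !sub_kermx -crd_lie coordinates_eq0 -mem_lie_cent.
  rewrite memv_cap; congr (_ && _); apply/eqP/idP.
    by move=> /coordinates_orth; apply: orth_m.
  move=> yk; apply/coordinates_orth => u /mem_m um.
  by rewrite /trace_form mxtrace_mulC; apply: um.
pose y := \sum_i (w i)%:R *: (vbasis m)`_i.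
have ym : y \in m by apply: mem_sum_vbasis.
have yE : map_mx iota (crd y) = (\row_i (w i)%:R) *m map_mx iota (U_mx m).
  have -> : crd y = (\row_i (w i)%:R) *m U_mx m.
    by rewrite mul_vspace_mx; congr (crd _); apply: eq_bigr => i _; rewrite mxE.
  by rewrite map_mxM; congr (_ *m _); apply/rowP => i; rewrite !mxE rmorph_nat.
have miny := min_dim_le (@lie_cent R g) ym; have dy := rank_lie_cent y.
move: wrk; rewrite -yE -map_lincomb mxrank_map => zy.
have arith (cz cy cx rz ry rx q D : nat) : (cz + rz)%N = D -> (cy + ry)%N = D ->
  (cx + rx)%N = D -> (rx <= rz)%N -> (rz <= ry)%N -> cx = q -> (q <= cy)%N -> cz = q by lia.
exact: arith dz dy dx zx zy dimx1 miny.
Qed.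
End Main.

(** * A vector of m~ with uniform centralisers *)

Local Open Scope classical_set_scope.

Theorem proposition2p11 (R : realType) (g : lieAlgebraType R)
  (n : nat) (chi : {linear g -> 'M[R]_n})
  (chi_rep : lie_representation chi)
  (chi_faithful : injective chi)
  (chi_neg : forall x : g, x != 0 -> trace_form chi x x < 0)
  (sigma : 'End(g))
  (sigma_aut : lie_automorphism sigma)
  (sigma_inv : involutive sigma)
  (sigma_isom : forall x y : g,
     trace_prod chi (sigma x) (sigma y) = trace_prod chi x y)
  (a : g) (a_in : a \in passmx.leigenspace sigma (-1))
  (t : {vspace g}) (t_cartan : cartan_subalgebra t) (a_in_t : a \in t)
  (E : 'Hom(subvs_of (complexifyv t), R[i]^o) -> complexification g)
  (E_weyl : weyl_basis (complexify_form (trace_form chi)) E)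
  (E_real : adapted_to_real_form E) :
  let g_plus := passmx.leigenspace sigma 1 in
  let k := lie_cent a in
  let m := orthov (trace_prod chi) k in
  let m_plus := (m :&: g_plus)%VS in
  let Delta := root_system (complexifyv t) in
  let Delta_k := [set alpha | Delta alpha /\ wt alpha (toC a) = 0] in
  let Delta_m := Delta `\` Delta_k in
  regular_set k m `&` [set` m_plus] !=set0 ->
  (forall x, regular_set k m x -> (lie_cent x :&: k)%VS = lie_center g) ->
  (exists pi : seq 'Hom(subvs_of (complexifyv t), R[i]^o),
     [/\ simple_roots pi,
         [set` pi] `<=` Delta_m
       & exists c d : 'Hom(subvs_of (complexifyv t), R[i]^o) -> R[i],
           (forall alpha, alpha \in pi -> c alpha != 0) /\
           \sum_(alpha <- pi) c alpha *: E (- alpha) +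
           \sum_(beta \in Delta_m `&` positive_roots pi) d beta *: E beta
             \in complexifyv m_plus]) ->
  uniform_set a m `&` [set` m_plus] !=set0.
Proof.
move=> g_plus k m m_plus Delta Delta_k Delta_m [x1 [x1_reg x1m_plus]] kx _.
have [_ dimx1 _] := x1_reg.
have sigma_a : sigma a = - a.
  by move: a_in; rewrite mem_leigenspace scaleN1r => /eqP.
(* The given vector [x1] is the point of reference: its centraliser has least dimension and meets
   [k] in the centre. *)
have [x0 x0m x0u] := exists_uniform_plus chi_rep chi_neg sigma_aut sigma_inv
  sigma_isom sigma_a x1m_plus dimx1 (kx _ x1_reg).
exists x0; split; last exact: x0m.
by split; [move: x0m; rewrite memv_cap => /andP[] | exact: x0u].
Qed.
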